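(* Let $D=\sum_j u_j\{p_j\}+u\{\infty\}$ be an Arakelov divisor on $\overline{\mathrm{Spec}\,\mathbb{Z}}$, let $H^0_{\mathbb{C}}(D)=(L\subset E,\|\cdot\|)$ be the associated pair, and let $dp$ be the unique probability measure on the one dimensional complex Hilbert space $E$ that is rotation invariant, for which any two orthogonal real linear forms are independent random variables, and for which the mean value of the norm is $\tfrac12$. Then $$\exp\left(h^0_\theta(D)\right)=\int_E[\xi/L]\,dp(\xi).$$
   Context: An Arakelov divisor on $\overline{\mathrm{Spec}\,\mathbb{Z}}$ is a formal finite sum $D=\sum_j u_j\{p_j\}+u\{\infty\}$ with $p_j$ distinct primes, $u_j\in\mathbb{Z}$, $u\in\mathbb{R}$; $D_{\mathrm{finite}}=\sum_j u_j\{p_j\}$. The sheaf $\mathcal{O}(D_{\mathrm{finite}})$ is viewed as a subsheaf of the constant sheaf $\mathbb{Q}$, with global sections $$L=H^0(\mathrm{Spec}\,\mathbb{Z},\mathcal{O}(D_{\mathrm{finite}}))=\{q\in\mathbb{Q}: |q|_{p_j}\le p_j^{u_j}\ \forall j,\ |q|_p\le 1 \text{ for all other primes } p\}.$$ The euclidean lattice associated to $D$ is $H^0(D)=(L,e^{-u}|\cdot|)$, where $|\cdot|$ is the usual absolute value. For a euclidean lattice $\overline{L}=(L,\|\cdot\|)$ the theta invariant is $h^0_\theta(\overline L)=\log\sum_{v\in L}\exp(-\pi\|v\|^2)$, and $h^0_\theta(D):=h^0_\theta(H^0(D))$. $H^0_{\mathbb{C}}(D)=(L\subset E,\|\cdot\|)$,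 where $E=\mathbb{C}$ is the one dimensional complex Hilbert space with norm $\|z\|=e^{-u}|z|$ and $L\subset\mathbb{Q}\subset\mathbb{C}=E$ is the rank one discrete subgroup $L=H^0(\mathrm{Spec}\,\mathbb{Z},\mathcal{O}(D_{\mathrm{finite}}))=\{q\in\mathbb{Q}: |q|_{p_j}\le p_j^{u_j}\ \forall j,\ |q|_p\le 1 \text{ for all other primes } p\}$. For $\xi\in E$, $[\xi/L]:=\#\{\ell\in L:\|\ell\|\le\|\xi\|\}$. *)

(* Defs.v *)
From HB Require Import structures.
From mathcomp Require Import all_boot all_order all_algebra finmap.
From mathcomp Require Import complex.
From mathcomp Require Import all_classical all_reals all_analysis.

Set Implicit Arguments.
Unset Strict Implicit.
Unset Printing Implicit Defensive.

Import Order.TTheory GRing.Theory Num.Theory.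
Import numFieldNormedType.Exports.

Local Open Scope classical_set_scope.
Local Open Scope ring_scope.

Definition padic_val (p : nat) (q : rat) : int :=
  (logn p `|numq q|%N)%:Z - (logn p `|denq q|%N)%:Z.

Definition padic_abs (p : nat) (q : rat) : rat :=
  if q == 0 then 0 else p%:R ^ (- padic_val p q).

(* The formal sum of the finite part is a finitely supported function on the
   primes; primes with coefficient 0 are not in the support. *)
Record arakelov_divisor (R : realType) := ArakelovDivisor {
  fin_part : {fsfun {p : nat | prime p} -> int with 0};
  inf_part : R }.

(* The global sections of O(D_finite), as a subgroup of the rationals *)
Definition sections (R : realType) (D : arakelov_divisor R) : set rat :=
  [set q | (forall p : {p : nat | prime p}, p \in finsupp (fin_part D) ->
              padic_abs (sval p) q <= (sval p)%:R ^ fin_part D p) /\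
           (forall p : {p : nat | prime p}, p \notin finsupp (fin_part D) ->
              padic_abs (sval p) q <= 1)].

Definition theta_invariant (R : realType) (V : choiceType) (L : set V)
    (N : V -> R) : R :=
  ln (fine (\esum_(v in L) (expR (- (pi * N v ^+ 2)))%:E)).

Definition h0_theta (R : realType) (D : arakelov_divisor R) : R :=
  theta_invariant (sections D)
    (fun q : rat => expR (- inf_part D) * `|ratr q : R|).

(* The complex numbers with their Borel sigma-algebra; the alias ^o gives
   access to the topology defined by the modulus. *)
Definition borelC (R : realType) :=
  g_sigma_algebraType (@open (R[i])^o).

Section ComplexPair.
Variables (R : realType) (D : arakelov_divisor R).

Definition sectionsC : set R[i] := [set ratr q | q in sections D].

(* The modulus of z is a real element of R[i]; Re brings it back into R. *)
Definition normE (z : R[i]) : R := expR (- inf_part D) * complex.Re `|z|.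

(* The real scalar product underlying the Hermitian structure of norm normE *)
Definition innerE (z w : R[i]) : R :=
  expR (- inf_part D) ^+ 2 * complex.Re (z * w^*)%C.

Definition real_linear_form (f : R[i] -> R) : Prop :=
  (forall z w, f (z + w) = f z + f w) /\
  (forall (a : R) z, f (a%:C%C * z) = a * f z).

(* Orthogonality in the dual, transported by the Riesz isomorphism *)
Definition orthogonal_forms (f g : R[i] -> R) : Prop :=
  exists a b : R[i],
    [/\ forall z, f z = innerE z a, forall z, g z = innerE z b
      & innerE a b = 0].

Definition independent (P : probability (borelC R) R) (f g : R[i] -> R) :
    Prop :=
  forall A B : set R, measurable A -> measurable B ->
    P (f @^-1` A `&` g @^-1` B) = (P (f @^-1` A) * P (g @^-1` B))%E.

Definition rotation_invariant (P : probability (borelC R) R) : Prop :=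
  forall w : R[i], `|w| = 1 -> forall A : set (borelC R), measurable A ->
    P ((fun z : R[i] => w * z) @^-1` A) = P A.

Record is_canonical_measure (P : probability (borelC R) R) : Prop := IsCanonicalMeasure {
  cm_rotation : rotation_invariant P;
  cm_independent : forall f g : R[i] -> R,
    real_linear_form f -> real_linear_form g -> orthogonal_forms f g ->
    independent P f g;
  cm_mean : (\int[P]_xi (normE xi)%:E = (2^-1)%:E)%E }.

Definition bracket (xi : R[i]) : \bar R :=
  counting [set l | sectionsC l /\ normE l <= normE xi].

End ComplexPair.

(* Main.v *)
Require Import Defs.
From mathcomp Require Import all_boot all_order all_algebra finmap.
From mathcomp Require Import complex.
From mathcomp Require Import all_classical all_reals all_analysis.
From mathcomp Require Import measurable_realfun ring lra.

Set Implicit Arguments.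
Unset Strict Implicit.
Unset Printing Implicit Defensive.

Import Order.TTheory GRing.Theory Num.Theory.
Import numFieldNormedType.Exports.

Local Open Scope classical_set_scope.
Local Open Scope ring_scope.

(** Both sides are the sum over the sections q in L of the probability that a
    random vector is at least as long as q.  For the right-hand side this is
    Tonelli: [xi/L] is a sum over the countable set L of indicators of
    |q| <= |xi|, so its mean is the sum of the probabilities P(|q| <= |xi|).
    For the left-hand side it amounts to the Gaussian tail
      P(r <= |xi|) = exp (- pi r^2)                    (canonical_measure_tail),
    together with the convergence of the theta series, which makes the
    logarithm in h0_theta harmless.  Convergence comes from the fact that L has
    bounded denominators (sections_denq_bounded), so that the series is
    dominated by a geometric series over the integers.

    The tail formula is the Herschel-Maxwell theorem: a rotation invariant
    plane measure with independent coordinates X and Y is Gaussian.  It is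
    obtained from moments.
    - The rotation by 45 degrees sends X Y to (Y^2 - X^2) / 2.  If |X|^m is
      integrable then so is |X Y|^m by independence, hence |Y^2 - X^2|^m, hence
      |X|^(2m): starting from the finite mean of the norm, all moments exist.
    - Comparing (X + Y)^(2k) + (X - Y)^(2k) with its image under the rotation
      gives a recursion that determines the even moments of X from E X^2
      (gauss_moment_unique).  They are the Gaussian ones, and this makes
      E (X^2 + Y^2)^k equal to k! (2 E X^2)^k (maxwell_factorial_moments).
    - The moments k! characterise the exponential law
      (eq_tail_factorial_moments).  Taylor expansion of exp (- h X) with
      explicit remainder propagates the equality of the Laplace transforms from
      l to l + h for small h, hence to all natural numbers; a second Taylor
      expansion gives the means of exp (- c exp (m (t - X))), which tend to
      P(X > t) + exp (- c) P(X = t) as m grows, and two values of c separate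
      the two probabilities.
    Finally the radius is a multiple of a variable with tail exp (- r^2), and
    the Gauss integral together with the mean 1/2 fixes the multiple. *)

(** * Taylor expansion of the exponential at a negative argument *)

(** The remainder of order n of exp (- x), multiplied by (-1)^n.  The sign makes
    all remainders nonnegative, each one being the derivative of the next. *)
Fixpoint expRN_rem (R : realType) (n : nat) (x : R) : R :=
  if n is m.+1 then x ^+ m / m`!%:R - expRN_rem m x else expR (- x).

Lemma is_derive_pow_fact (R : realType) (n : nat) (x : R) :
  is_derive x (1 : R) (fun y : R => y ^+ n.+1 / n.+1`!%:R) (x ^+ n / n`!%:R).
Proof.
have -> : (fun y : R => y ^+ n.+1 / n.+1`!%:R) = n.+1`!%:R^-1 *: (id ^+ n.+1 : R -> R).
  by apply/funext => y; rewrite !fctE /GRing.scale /= mulrC.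
have -> : x ^+ n / n`!%:R = n.+1`!%:R^-1 *: ((n.+1%:R * x ^+ n) *: (1 : R)) :> R.
  rewrite /GRing.scale /= factS natrM mulr1.
  have n1 : n.+1%:R != 0 :> R by rewrite pnatr_eq0.
  by rewrite invfM mulrACA mulVf// mul1r mulrC.
by apply: is_deriveZ; exact: (is_deriveX n.+1 (is_derive_id x (1 : R))).
Qed.

Lemma is_derive_expRN_rem (R : realType) (n : nat) (x : R) :
  is_derive x (1 : R) (expRN_rem n.+1) (expRN_rem n x).
Proof.
elim: n => [|n IHn].
  have -> : @expRN_rem R 1 = (fun y : R => 1 - expR (- y)).
    by apply/funext => y /=; rewrite expr0 fact0 divr1.
  by apply: is_derive_eq; rewrite /GRing.scale /=; ring.
exact: (is_deriveB (is_derive_pow_fact n x) IHn).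
Qed.

Lemma expRN_rem_ge0 (R : realType) (n : nat) (x : R) :
  0 <= x -> 0 <= expRN_rem n x.
Proof.
elim: n x => [|n IHn] x x0; first exact: expR_ge0.
have rem0 : expRN_rem n.+1 (0 : R) = 0.
  elim: {IHn x x0} n => [|n /= ->]; first by rewrite /= oppr0 expR0 expr0 fact0 divr1 subrr.
  by rewrite expr0n mul0r subr0.
rewrite -rem0.
have dr (y : R) := @is_derive_expRN_rem R n y.
apply: (@ger0_derive1_le_cc R (expRN_rem n.+1) 0 x) => //.
- move=> y; rewrite in_itv /= derive1E (@derive_val _ _ _ _ _ _ _ (dr y)).
  by move=> /andP[/ltW y0 _]; exact: IHn.
- apply: continuous_subspaceT => y; apply: differentiable_continuous.
  by apply/derivable1_diffP; exact: (@ex_derive _ _ _ _ _ _ _ (dr y)).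
- by rewrite in_itv /= lexx.
- by rewrite in_itv /= lexx x0.
Qed.

(** The series is alternating: two consecutive signed remainders are nonnegative
    and add up to the n-th term, so each is at most that term. *)
Lemma expRN_taylor (R : realType) (n : nat) (x : R) : 0 <= x ->
  `|expR (- x) - \sum_(j < n) (- x) ^+ j / j`!%:R| <= x ^+ n / n`!%:R.
Proof.
move=> x0.
have -> : expR (- x) - \sum_(j < n) (- x) ^+ j / j`!%:R = (-1) ^+ n * expRN_rem n x.
  elim: n => [|n IHn]; first by rewrite big_ord0 subr0 mul1r.
  rewrite big_ord_recr /= opprD addrA IHn exprS (exprNn x); ring.
rewrite normrM normrX normrN1 expr1n mul1r ger0_norm ?expRN_rem_ge0//.
by have := expRN_rem_ge0 n.+1 x0; rewrite /= subr_ge0.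
Qed.
Lemma integrable_Rsum d (T : measurableType d) (R : realType)
    (mu : {measure set T -> \bar R}) (n : nat) (f : nat -> T -> R) :
  (forall j, (j < n)%N -> mu.-integrable setT (EFin \o f j)) ->
  mu.-integrable setT (EFin \o (fun w => \sum_(j < n) f j w)).
Proof.
move=> fi; have -> : EFin \o (fun w => \sum_(j < n) f j w) =
    (fun w => \sum_(j < n) (f j w)%:E)%E.
  by apply/funext => w /=; rewrite sumEFin.
by apply: integrable_sum => // j _; exact: fi.
Qed.

Lemma Rintegral_sum d (T : measurableType d) (R : realType)
    (mu : {measure set T -> \bar R}) (n : nat) (f : nat -> T -> R) :
  (forall j, (j < n)%N -> mu.-integrable setT (EFin \o f j)) ->
  \int[mu]_w (\sum_(j < n) f j w) = \sum_(j < n) \int[mu]_w f j w.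
Proof.
elim: n => [|n IHn] fi.
  by under eq_Rintegral do rewrite big_ord0; rewrite Rintegral_cst// mul0r big_ord0.
under eq_Rintegral do rewrite big_ord_recr /=.
rewrite RintegralD//; last 2 first.
- by apply: integrable_Rsum => j jn; apply: fi; rewrite ltnW.
- exact: fi.
by rewrite IHn ?big_ord_recr// => j jn; apply: fi; rewrite ltnW.
Qed.

(** This serves twice: with Z = h X to move along the Laplace transform of X, and
    with Z = c exp (m (t - X)) to approximate the indicator of X > t. *)
Lemma Rintegral_expRN_taylor d (T : measurableType d) (R : realType)
    (mu : {measure set T -> \bar R}) (Y Z : T -> R) (n : nat) :
  measurable_fun setT Y -> measurable_fun setT Z ->
  (forall w, 0 <= Y w) -> (forall w, 0 <= Z w) ->
  (forall j, (j <= n)%N -> mu.-integrable setT (EFin \o (fun w => Y w * Z w ^+ j))) ->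
  `|\int[mu]_w (Y w * expR (- Z w)) -
    \sum_(j < n) (-1) ^+ j / j`!%:R * \int[mu]_w (Y w * Z w ^+ j)| <=
  \int[mu]_w (Y w * Z w ^+ n) / n`!%:R.
Proof.
move=> mY mZ Y0 Z0 YZi.
have mE : measurable_fun setT (fun w => Y w * expR (- Z w)).
  by apply: measurable_funM => //; apply: measurableT_comp => //; exact: measurableT_comp.
have Ei : mu.-integrable setT (EFin \o (fun w => Y w * expR (- Z w))).
  apply: le_integrable (YZi 0 _) => //; first exact/measurable_EFinP.
  move=> w _ /=; rewrite expr0 mulr1 lee_fin !ger0_norm ?mulr_ge0 ?expR_ge0//.
  by rewrite ler_piMr// -expR0 ler_expR oppr_le0.
have Si j : (j < n)%N -> mu.-integrable setT
    (EFin \o (fun w => (-1) ^+ j / j`!%:R * (Y w * Z w ^+ j))).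
  move=> jn; have := integrableZl measurableT ((-1) ^+ j / j`!%:R) (YZi j (ltnW jn)).
  by apply: eq_integrable.
have <- : \int[mu]_w (\sum_(j < n) ((-1) ^+ j / j`!%:R * (Y w * Z w ^+ j))) =
    \sum_(j < n) (-1) ^+ j / j`!%:R * \int[mu]_w (Y w * Z w ^+ j).
  rewrite (@Rintegral_sum _ _ _ _ _ (fun j w => (-1) ^+ j / j`!%:R * (Y w * Z w ^+ j)))//.
  by apply: eq_bigr => j _; rewrite RintegralZl// YZi// ltnW.
have Ssi := integrable_Rsum Si.
rewrite -RintegralB//.
have Di : mu.-integrable setT (EFin \o (fun w => Y w * expR (- Z w) -
    \sum_(j < n) (-1) ^+ j / j`!%:R * (Y w * Z w ^+ j))).
  by have := integrableB measurableT Ei Ssi; apply: eq_integrable.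
apply: le_trans (le_normr_Rintegral _ Di) _ => //.
rewrite -RintegralZr ?YZi//.
apply: le_Rintegral => //.
- exact: (integrable_norm Di).
- have := integrableZr measurableT (n`!%:R^-1) (YZi n (leqnn _)).
  by apply: eq_integrable.
move=> w _; have := ler_wpM2l (Y0 w) (expRN_taylor n (Z0 w)).
rewrite -{1}(ger0_norm (Y0 w)) -normrM mulrA; congr (_ <= _); congr (`|_|).
rewrite mulrBr mulr_sumr; congr (_ - _); apply: eq_bigr => j _.
by rewrite (exprNn (Z w)); ring.
Qed.
(** * Laws with moments k! *)

Definition laplace_moment d (T : measurableType d) (R : realType)
    (P : probability T R) (X : T -> R) (k : nat) (l : R) : R :=
  \int[P]_w (X w ^+ k * expR (- (l * X w))).

Definition factorial_moments d (T : measurableType d) (R : realType)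
    (P : probability T R) (X : T -> R) : Prop :=
  [/\ measurable_fun setT X, forall w, 0 <= X w &
      forall k, P.-integrable setT (EFin \o (fun w => X w ^+ k)) /\
                \int[P]_w (X w ^+ k) = k`!%:R].

Section FactorialMoments.
Context d (T : measurableType d) (R : realType).
Variables (P : probability T R) (X : T -> R).
Hypothesis XP : factorial_moments P X.

Let mX : measurable_fun setT X. Proof. by case: XP. Qed.
Let X0 w : 0 <= X w. Proof. by case: XP. Qed.
Let iX k : P.-integrable setT (EFin \o (fun w => X w ^+ k)).
Proof. by case: XP => _ _ /(_ k)[]. Qed.
Let momX k : \int[P]_w (X w ^+ k) = k`!%:R.
Proof. by case: XP => _ _ /(_ k)[]. Qed.

Lemma measurable_expRNM (l : R) : measurable_fun setT (fun w => expR (- (l * X w))).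
Proof.
apply: measurableT_comp => //; apply: measurableT_comp => //.
exact: measurable_funM.
Qed.

Lemma integrable_laplace_moment (k : nat) (l : R) : 0 <= l ->
  P.-integrable setT (EFin \o (fun w => X w ^+ k * expR (- (l * X w)))).
Proof.
move=> l0; apply: le_integrable (iX k) => //.
  apply/measurable_EFinP; apply: measurable_funM (measurable_expRNM l).
  exact: measurable_funX.
move=> w _ /=; rewrite lee_fin !ger0_norm ?mulr_ge0 ?expR_ge0 ?exprn_ge0//.
by rewrite ler_piMr ?exprn_ge0// -expR0 ler_expR oppr_le0 mulr_ge0.
Qed.

Lemma laplace_moment_le (k : nat) (l : R) : 0 <= l -> laplace_moment P X k l <= k`!%:R.
Proof.
move=> l0; rewrite -momX; apply: le_Rintegral => //.
- exact: integrable_laplace_moment.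
- move=> w _; rewrite ler_piMr ?exprn_ge0// -expR0 ler_expR oppr_le0.
  exact: mulr_ge0.
Qed.

(** The remainder is at most h^n / n! times the moment (k + n)!, and the quotient
    (k + n)! / n! is k! times a binomial coefficient bounded by 2^(k + n): the
    expansion at l converges for 2 h < 1, uniformly in l. *)
Lemma laplace_moment_taylor (k n : nat) (l h : R) : 0 <= l -> 0 <= h ->
  `|laplace_moment P X k (l + h) -
    \sum_(j < n) (-1) ^+ j / j`!%:R * (h ^+ j * laplace_moment P X (k + j) l)|
  <= k`!%:R * 2 ^+ k * (2 * h) ^+ n.
Proof.
move=> l0 h0.
have LE j : \int[P]_w (X w ^+ k * expR (- (l * X w)) * (h * X w) ^+ j) =
    h ^+ j * laplace_moment P X (k + j) l.
  rewrite -RintegralZl//; last exact: integrable_laplace_moment.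
  by apply: eq_Rintegral => w _; rewrite exprMn exprD; ring.
have := @Rintegral_expRN_taylor _ _ _ P (fun w => X w ^+ k * expR (- (l * X w)))
  (fun w => h * X w) n.
under eq_bigr do rewrite LE.
rewrite LE (_ : \int[P]_w _ = laplace_moment P X k (l + h)); last first.
  by apply: eq_Rintegral => w _; rewrite -mulrA -expRD -opprD -mulrDl.
move=> H; apply: le_trans (H _ _ _ _ _) _.
- apply: measurable_funM (measurable_expRNM l); exact: measurable_funX.
- exact: measurable_funM.
- by move=> w; rewrite mulr_ge0 ?expR_ge0 ?exprn_ge0.
- by move=> w; exact: mulr_ge0.
- move=> j _; have := integrableZl measurableT (h ^+ j) (integrable_laplace_moment (k + j) l0).
  apply: eq_integrable => // w _; rewrite /= -EFinM; congr _%:E.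
  by rewrite exprMn exprD; ring.
have n0 : (0 : R) < n`!%:R by rewrite ltr0n fact_gt0.
rewrite ler_pdivrMr// exprMn.
apply: le_trans (ler_wpM2l (exprn_ge0 n h0) (laplace_moment_le (k + n) l0)) _.
rewrite -(@bin_fact (k + n) k (leq_addr _ _)) addKn !natrM.
have H2 : ('C(k + n, k))%:R <= 2 ^+ k * 2 ^+ n :> R.
  rewrite -exprD -natrX ler_nat -[2%N]/(1 + 1)%N expnDn.
  have kn : (k < (k + n).+1)%N by rewrite ltnS leq_addr.
  rewrite (bigD1 (Ordinal kn))//= !exp1n !muln1; exact: leq_addr.
have F0 : 0 <= h ^+ n * (k`!%:R * n`!%:R) by rewrite !mulr_ge0 ?exprn_ge0.
have := ler_wpM2l F0 H2; congr (_ <= _); ring.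
Qed.

End FactorialMoments.
Lemma eq_of_dist_cvg0 (R : realType) (a b : R) (u : R^nat) :
  u @ \oo --> (0 : R) -> (forall n, `|a - b| <= u n) -> a = b.
Proof.
move=> u0 abu; apply/eqP; rewrite -subr_eq0 -normr_le0.
have -> : 0 = limn u by exact/esym/cvg_lim.
apply: limr_ge; first by apply/cvg_ex; exists 0.
exact: nearW.
Qed.

Section SameFactorialMoments.
Context d (T : measurableType d) d' (T' : measurableType d') (R : realType).
Variables (P : probability T R) (X : T -> R).
Variables (P' : probability T' R) (X' : T' -> R).
Hypotheses (XP : factorial_moments P X) (XP' : factorial_moments P' X').

Let dist_taylor (a b s u v : R) : `|a - s| <= u -> `|b - s| <= v -> `|a - b| <= u + v.
Proof.
move=> asu bsv; rewrite (_ : a - b = (a - s) - (b - s)); last by ring.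
by apply: le_trans (ler_normB _ _) _; exact: lerD.
Qed.

(** The Taylor coefficients at l of the Laplace transform are again Laplace
    moments at l, and the step h can be chosen independently of l: equality at
    0 spreads to the whole half-line, although the moment generating functions
    have a finite radius of convergence. *)
Lemma laplace_moment_shift (l h : R) : 0 <= l -> 0 <= h -> 2 * h < 1 ->
  (forall k, laplace_moment P X k l = laplace_moment P' X' k l) ->
  forall k, laplace_moment P X k (l + h) = laplace_moment P' X' k (l + h).
Proof.
move=> l0 h0 h1 eql k.
apply: (@eq_of_dist_cvg0 _ _ _ (fun n => geometric (k`!%:R * 2 ^+ k *+ 2) (2 * h) n)).
  by apply: cvg_geometric; rewrite ger0_norm// mulr_ge0.
move=> n; rewrite /= mulrnAl mulr2n.
have XT := laplace_moment_taylor XP k n l0 h0.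
have := laplace_moment_taylor XP' k n l0 h0.
under eq_bigr do rewrite -eql.
exact: dist_taylor.
Qed.

(** The step 1/4 satisfies the condition 2 h < 1 of the previous lemma. *)
Lemma laplace_moment_nat (n k : nat) :
  laplace_moment P X k n%:R = laplace_moment P' X' k n%:R.
Proof.
have H i : forall k, laplace_moment P X k (i%:R / 4) = laplace_moment P' X' k (i%:R / 4).
  elim: i => [|i IHi] j.
    rewrite mul0r /laplace_moment.
    under eq_Rintegral do rewrite mul0r oppr0 expR0 mulr1.
    under [RHS]eq_Rintegral do rewrite mul0r oppr0 expR0 mulr1.
    case: XP => _ _ /(_ j)[_ ->]; by case: XP' => _ _ /(_ j)[_ ->].
  rewrite -natr1 mulrDl mul1r; apply: laplace_moment_shift => //.
  lra.
have -> : n%:R = (4 * n)%:R / 4 :> R by rewrite natrM; field.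
exact: H.
Qed.

(** Expanding the outer exponential only involves the means of exp (- j m X), that
    is, values of the Laplace transform at natural numbers. *)
Lemma double_exp_eq (c t : R) (m : nat) : 0 <= c ->
  \int[P]_w expR (- (c * expR (m%:R * (t - X w)))) =
  \int[P']_w expR (- (c * expR (m%:R * (t - X' w)))).
Proof.
move=> c0.
(* the common partial sums that approximate both sides *)
pose s n := \sum_(j < n) (-1) ^+ j / j`!%:R *
  ((c * expR (m%:R * t)) ^+ j * laplace_moment P X 0 (j * m)%:R).
have key d0 (T0 : measurableType d0) (P0 : probability T0 R) (X0 : T0 -> R) :
    factorial_moments P0 X0 ->
    (forall j, laplace_moment P0 X0 0 (j * m)%:R = laplace_moment P X 0 (j * m)%:R) ->
    forall n, `|\int[P0]_w expR (- (c * expR (m%:R * (t - X0 w)))) - s n| <=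
      (c * expR (m%:R * t)) ^+ n / n`!%:R.
  move=> F eqL n; set a := c * _ in s *; have a0 : 0 <= a by rewrite mulr_ge0 ?expR_ge0.
  have [mX X0p _] := F.
  pose Z w := c * expR (m%:R * (t - X0 w)).
  have Z0 w : 0 <= Z w by rewrite mulr_ge0 ?expR_ge0.
  have ZE w j : Z w ^+ j = a ^+ j * (X0 w ^+ 0 * expR (- ((j * m)%:R * X0 w))).
    rewrite expr0 mul1r /Z /a mulrBr expRD mulrA exprMn; congr (_ * _).
    by rewrite -expRM_natr natrM; congr expR; ring.
  have ZI j : P0.-integrable setT (EFin \o (fun w => (1 : R) * Z w ^+ j)).
    have := integrableZl measurableT (a ^+ j)
      (@integrable_laplace_moment _ _ _ _ _ F 0 (j * m)%:R (ler0n _ _)).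
    by apply: eq_integrable => // w _; rewrite /= -EFinM mul1r ZE.
  have ZL j : \int[P0]_w ((1 : R) * Z w ^+ j) = a ^+ j * laplace_moment P X 0 (j * m)%:R.
    rewrite -eqL -RintegralZl//; last exact: integrable_laplace_moment.
    by apply: eq_Rintegral => w _; rewrite mul1r ZE.
  have := @Rintegral_expRN_taylor _ _ _ P0 (fun=> 1) Z n.
  under eq_bigr do rewrite ZL.
  rewrite (_ : \int[P0]_w ((1 : R) * expR (- Z w)) =
    \int[P0]_w expR (- (c * expR (m%:R * (t - X0 w)))));
    last by apply: eq_Rintegral => w _; rewrite mul1r.
  move=> H; apply: le_trans (H _ _ _ _ _) _ => //.
  - apply: measurable_funM => //; apply: measurableT_comp => //.
    apply: measurable_funM => //; exact: measurable_funB.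
  - rewrite ZL ler_pM2r ?invr_gt0 ?ltr0n ?fact_gt0//.
    rewrite ler_piMr ?exprn_ge0//.
    rewrite -eqL; apply: le_trans (laplace_moment_le F 0 (ler0n _ _)) _.
    by rewrite fact0.
apply: (@eq_of_dist_cvg0 _ _ _ (fun n => (exp_coeff (c * expR (m%:R * t)) n) *+ 2)).
  rewrite -(mul0rn _ 2); apply: cvgMn.
  exact: cvg_exp_coeff.
move=> n; rewrite mulr2n; apply: (@dist_taylor _ _ (s n)); apply: key => // j.
by rewrite laplace_moment_nat.
Qed.

End SameFactorialMoments.
Lemma double_exp_cvg (R : realType) (c a : R) : 0 < c ->
  (fun m : nat => expR (- (c * expR (m%:R * a)))) @ \oo -->
  (if a < 0 then 1 else if a == 0 then expR (- c) else 0).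
Proof.
move=> c0; case: ltgtP => [a0|a0|->].
- rewrite -[X in _ --> X]expR0 -oppr0 -[X in - X](mulr0 c).
  apply: continuous_cvg; first exact: continuous_expR.
  apply: cvgN; apply: cvgM; first exact: cvg_cst.
  have -> : (fun m : nat => expR (m%:R * a)) = geometric 1 (expR a).
    by apply/funext => m; rewrite /= mul1r expRM_natl.
  by apply: cvg_geometric; rewrite ger0_norm ?expR_ge0// expR_lt1.
- apply: (@squeeze_cvgr _ _ _ _ (cst 0) (geometric 1 (expR (- (c * a))))).
  + apply: nearW => m; rewrite expR_ge0 /= mul1r -expRM_natl ler_expR mulrN lerN2.
    rewrite mulrCA ler_wpM2l ?(ltW c0)//.
    by apply: le_trans (expR_ge1Dx _); rewrite lerDr.
  + exact: cvg_cst.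
  + apply: cvg_geometric; rewrite ger0_norm ?expR_ge0// expR_lt1 oppr_lt0.
    exact: mulr_gt0.
- rewrite (_ : (fun m : nat => _) = cst (expR (- c))); first exact: cvg_cst.
  by apply/funext => m; rewrite mulr0 expR0 mulr1.
Qed.

(** The function exp (- c exp (m (t - x))) of x becomes a step at t as m grows; the
    height exp (- c) at the point t itself depends on c, which allows an atom at
    t to be told apart from the mass beyond t. *)
Lemma double_exp_integral_cvg d (T : measurableType d) (R : realType)
    (P : probability T R) (X : T -> R) (c t : R) :
  measurable_fun setT X -> 0 < c ->
  (fun m : nat => (\int[P]_w (expR (- (c * expR (m%:R * (t - X w)))))%:E)%E) @ \oo -->
  (P [set w | (t < X w)%R] + (expR (- c))%:E * P [set w | X w = t])%E.
Proof.
move=> mX c0.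
have mgt : measurable [set w | t < X w].
  rewrite (_ : [set w | _] = setT `&` X @^-1` `]t, +oo[); first exact: mX.
  by apply/seteqP; split => w /=; rewrite in_itv /= andbT // => -[].
have meq : measurable [set w | X w = t].
  by rewrite (_ : [set w | _] = setT `&` X @^-1` [set t]); [exact: mX|rewrite setTI].
pose g w := ((\1_[set w | (t < X w)%R] w)%:E + (expR (- c))%:E * (\1_[set w | X w = t] w)%:E)%E.
have gE w : g w = (if t - X w < 0 then 1 else if t - X w == 0 then expR (- c) else 0)%:E.
  rewrite /g !indicE subr_lt0 subr_eq0.
  case: ltgtP => [tX|tX|tX].
  - by rewrite mem_set// memNset ?mule0 ?adde0//= => Xt; rewrite Xt ltxx in tX.
  - rewrite memNset//=; last by rewrite ltNge (ltW tX).
    by rewrite memNset ?mule0 ?adde0//= => Xt; rewrite Xt ltxx in tX.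
  - by rewrite memNset/= ?tX ?ltxx// mem_set//= mule1 add0e.
have mg : measurable_fun setT g.
  apply: emeasurable_funD; first by apply/measurable_EFinP.
  by apply: emeasurable_funM => //; exact/measurable_EFinP.
have <- : (\int[P]_w g w = P [set w | (t < X w)%R] + (expR (- c))%:E * P [set w | X w = t])%E.
  rewrite ge0_integralD//.
  - by rewrite ge0_integralZl_EFin ?expR_ge0// ?integral_indic// ?setIT//; exact/measurable_EFinP.
  - exact/measurable_EFinP.
  - by apply: emeasurable_funM => //; exact/measurable_EFinP.
have [] := @dominated_convergence _ _ _ P setT measurableT
  (fun m w => (expR (- (c * expR (m%:R * (t - X w)))))%:E) g (cst 1%E).
- move=> m; apply/measurable_EFinP; apply: measurableT_comp => //.
  apply: measurableT_comp => //; apply: measurable_funM => //.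
  apply: measurableT_comp => //; apply: measurable_funM => //.
  exact: measurable_funB.
- exact: mg.
- apply: nearW => w _; rewrite gE; apply: cvg_EFin; first exact: nearW.
  exact: double_exp_cvg.
- exact: finite_measure_integrable_cst.
- apply: nearW => w m _; rewrite lee_fin ger0_norm ?expR_ge0//.
  by rewrite -expR0 ler_expR oppr_le0 mulr_ge0 ?expR_ge0// ltW.
- by [].
Qed.
Lemma integrable_double_exp d (T : measurableType d) (R : realType)
    (P : probability T R) (X : T -> R) (c t : R) (m : nat) :
  measurable_fun setT X -> 0 < c ->
  P.-integrable setT (EFin \o (fun w => expR (- (c * expR (m%:R * (t - X w)))))).
Proof.
move=> mX c0; apply: le_integrable (finite_measure_integrable_cst P 1 measurableT) => //.
  apply/measurable_EFinP; apply: measurableT_comp => //.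
  apply: measurableT_comp => //; apply: measurable_funM => //.
  apply: measurableT_comp => //; apply: measurable_funM => //.
  exact: measurable_funB.
move=> w _; rewrite lee_fin normr1 ger0_norm ?expR_ge0//.
by rewrite -expR0 ler_expR oppr_le0 mulr_ge0 ?expR_ge0// ltW.
Qed.

(** The limits for c = 1 and c = 2 form an invertible linear system in the two
    unknowns P(X > t) and P(X = t). *)
Theorem eq_tail_factorial_moments d (T : measurableType d)
    d' (T' : measurableType d') (R : realType)
    (P : probability T R) (X : T -> R) (P' : probability T' R) (X' : T' -> R) :
  factorial_moments P X -> factorial_moments P' X' ->
  forall t, P [set w | t <= X w] = P' [set w | t <= X' w].
Proof.
move=> XP XP' t.
have [mX _ _] := XP; have [mX' _ _] := XP'.
have eqc (c : R) : 0 < c ->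
    (P [set w | (t < X w)%R] + (expR (- c))%:E * P [set w | X w = t] =
     P' [set w | (t < X' w)%R] + (expR (- c))%:E * P' [set w | X' w = t])%E.
  move=> c0; have H := @double_exp_integral_cvg _ _ _ P X c t mX c0.
  have H' := @double_exp_integral_cvg _ _ _ P' X' c t mX' c0.
  rewrite -(cvg_lim (@ereal_hausdorff R) H) -(cvg_lim (@ereal_hausdorff R) H').
  apply: congr_lim.
  apply/funext => m.
  have iX := @integrable_double_exp _ _ _ P X c t m mX c0.
  have iX' := @integrable_double_exp _ _ _ P' X' c t m mX' c0.
  rewrite -[LHS]fineK; last exact: (integrable_fin_num measurableT iX).
  rewrite -[RHS]fineK; last exact: (integrable_fin_num measurableT iX').
  by congr _%:E; exact: @double_exp_eq _ _ _ _ _ P X P' X' XP XP' c t m (ltW c0).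
have splitP d0 (T0 : measurableType d0) (P0 : probability T0 R) (X0 : T0 -> R) :
    measurable_fun setT X0 ->
    [/\ P0 [set w | (t <= X0 w)%R] = P0 [set w | (t < X0 w)%R] + P0 [set w | X0 w = t],
    P0 [set w | (t < X0 w)%R] \is a fin_num & P0 [set w | X0 w = t] \is a fin_num]%E.
  move=> m0.
  have mgt : measurable [set w | t < X0 w].
    rewrite (_ : [set w | _] = setT `&` X0 @^-1` `]t, +oo[); first exact: m0.
    by apply/seteqP; split => w /=; rewrite in_itv /= andbT // => -[].
  have meq : measurable [set w | X0 w = t].
    by rewrite (_ : [set w | _] = setT `&` X0 @^-1` [set t]); [exact: m0|rewrite setTI].
  split; [|exact: fin_num_measure|exact: fin_num_measure].
  rewrite -measureU//.
    congr (P0 _); apply/seteqP; split => w /=; first by rewrite le_eqVlt => /orP[/eqP|]; [right|left].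
    by case=> [/ltW//|->].
  by apply/seteqP; split => w //= -[+ wt]; rewrite wt ltxx.
have [-> f1 f2] := splitP _ _ P X mX; have [-> f1' f2'] := splitP _ _ P' X' mX'.
move: f1 f2 f1' f2' (eqc 1 ltr01) (eqc 2 (ltr0n _ 2)).
move=> /fineK <- /fineK <- /fineK <- /fineK <-; rewrite -!EFinM -!EFinD.
set p := fine _; set q := fine _; set p' := fine _; set q' := fine _.
move=> [e1] [e2]; congr _%:E.
have e12 : expR (- 2) < expR (- 1) :> R by rewrite ltr_expR ltrN2 ltr1n.
have : (expR (- 1) - expR (- 2)) * (q - q') = 0 by lra.
move=> /eqP; rewrite mulf_eq0 subr_eq0 gt_eqF//= subr_eq0 => /eqP qq.
by move: e1; rewrite qq => /addIr ->.
Qed.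
(** * The exponential law *)

(** The density agrees almost everywhere with the Radon-Nikodym derivative, for
    which the change of variables is available. *)
Lemma ge0_integral_density d (T : measurableType d) (R : realType)
    (nu : {finite_measure set T -> \bar R})
    (mu : {sigma_finite_measure set T -> \bar R}) (g f : T -> \bar R) :
  measurable_fun setT g ->
  (forall A, measurable A -> nu A = \int[mu]_(x in A) g x)%E ->
  measurable_fun setT f -> (forall x, 0 <= f x)%E ->
  (\int[nu]_x f x = \int[mu]_x (f x * g x))%E.
Proof.
move=> mg nug mf f0.
have numu : nu `<< mu.
  apply/null_content_dominatesP => A mA muA0; rewrite nug//.
  by apply: null_set_integral => //; exact: measurable_funTS.
have mrn := measurable_int _ (Radon_Nikodym_SigmaFinite.f_integrable numu).
rewrite -(Radon_Nikodym_SigmaFinite.change_of_variables numu f0 measurableT mf).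
apply: ae_eq_integral => //; [exact: emeasurable_funM|exact: emeasurable_funM|].
apply: ae_eqe_mul2l; apply: integral_ae_eq => //.
  exact: Radon_Nikodym_SigmaFinite.f_integrable.
by move=> E _ mE; rewrite -nug// -Radon_Nikodym_SigmaFinite.f_integral.
Qed.

(** From exp x = exp (x / (k + 1))^(k + 1) >= (x / (k + 1))^(k + 1). *)
Lemma cvg_exprn_expRN (R : realType) (k : nat) :
  x ^+ k * expR (- x) @[x --> +oo] --> (0 : R).
Proof.
apply: (@squeeze_cvgr _ _ _ _ (cst 0) (fun x => k.+1%:R ^+ k.+1 * x^-1)).
- near=> x; have x0 : 0 < x by near: x; exact: nbhs_pinfty_gt.
  rewrite mulr_ge0 ?expR_ge0 ?exprn_ge0 ?(ltW x0)//=.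
  rewrite expRN ler_pdivlMr// mulrAC ler_pdivrMr ?expR_gt0//.
  rewrite -exprSr; have -> : expR x = expR (x / k.+1%:R) ^+ k.+1.
    by rewrite -expRM_natr divfK// pnatr_eq0.
  rewrite -exprMn lerXn2r// ?nnegrE ?mulr_ge0 ?expR_ge0 ?(ltW x0)//.
  rewrite mulrC -ler_pdivrMr ?ltr0n//.
  by apply: le_trans (expR_ge1Dx _); rewrite lerDr.
- exact: cvg_cst.
- rewrite -[X in _ --> X](mulr0 (k.+1%:R ^+ k.+1 : R)).
  apply: cvgM; first exact: cvg_cst.
  by apply/(gtr0_cvgV0 (f := id)); [exact: nbhs_pinfty_gt|exact: cvg_id].
Unshelve. all: by end_near. Qed.

(** The primitive of x^k exp (- x) given by iterated integration by parts. *)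
Fixpoint expRN_primitive (R : realType) (k : nat) (x : R) : R :=
  if k is m.+1 then m.+1%:R * expRN_primitive m x - x ^+ k * expR (- x)
  else - expR (- x).

Lemma is_derive_expRN_primitive (R : realType) (k : nat) (x : R) :
  is_derive x (1 : R) (expRN_primitive k) (x ^+ k * expR (- x)).
Proof.
have dE : is_derive x (1 : R) (fun y : R => expR (- y)) (- expR (- x)).
  by apply: is_derive_eq; rewrite /GRing.scale /=; ring.
elim: k => [|k IHk].
  by apply: is_derive_eq; rewrite /GRing.scale /=; ring.
have dX : is_derive x (1 : R) (id ^+ k.+1 : R -> R) ((k.+1%:R * x ^+ k) *: (1 : R)).
  exact: (is_deriveX k.+1 (is_derive_id x (1 : R))).
have -> : expRN_primitive k.+1 =
    (k.+1%:R *: @expRN_primitive R k) - (id ^+ k.+1 : R -> R) * (fun y : R => expR (- y)).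
  by apply/funext => y; rewrite !fctE.
have := is_deriveB (is_deriveZ k.+1%:R IHk) (is_deriveM dX dE).
move=> H; apply: (is_derive_eq H).
rewrite !fctE /GRing.scale /=; ring.
Qed.
Lemma integral_exprn_expRN (R : realType) (k : nat) (a : R) : 0 <= a ->
  (\int[lebesgue_measure]_(x in `[a, +oo[) (x ^+ k * expR (- x))%:E =
   (- expRN_primitive k a)%:E)%E.
Proof.
move=> a0.
have dF (x : R) := @is_derive_expRN_primitive R k x.
have cF (x : R) : {for x, continuous (@expRN_primitive R k)}.
  apply: differentiable_continuous; apply/derivable1_diffP.
  exact: (@ex_derive _ _ _ _ _ _ _ (dF x)).
rewrite (@ge0_continuous_FTC2y _ _ (expRN_primitive k) a 0).
- by rewrite sub0e -EFinN.
- by move=> x ax; rewrite mulr_ge0 ?expR_ge0 ?exprn_ge0// (le_trans a0).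
- apply: continuous_subspaceT => x; apply: cvgM; first exact: exprn_continuous.
  by apply: continuous_comp; [exact: oppr_continuous|exact: continuous_expR].
- elim: k {dF cF} => [|k IHk] /=.
    by rewrite -oppr0; apply: cvgN; exact: cvgr_expR.
  rewrite -[X in _ --> X](subr0 0) -[X in _ --> X - _](mulr0 (k.+1%:R : R)).
  apply: cvgB; last exact: cvg_exprn_expRN.
  by apply: cvgM => //; exact: cvg_cst.
- by move=> x _; exact: (@ex_derive _ _ _ _ _ _ _ (dF x)).
- by apply: cvg_at_right_filter; exact: cF.
- by move=> x _; rewrite derive1E (@derive_val _ _ _ _ _ _ _ (dF x)).
Qed.

(** This provides the reference law to which a variable with moments k! is
    compared.  The absolute value turns the identity into a function that is
    nonnegative everywhere, not only on the support. *)
Lemma exponential_law (R : realType) : exists E : probability (measurableTypeR R) R,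
  factorial_moments E (fun x : measurableTypeR R => `|x|) /\
  forall t : R, 0 <= t -> E [set x | t <= `|x|] = (expR (- t))%:E.
Proof.
have [E EE] : exists E : probability (measurableTypeR R) R,
    forall A, E A = exponential_prob 1 A.
  by unshelve eexists (exponential_prob (1 : R) : probability (measurableTypeR R) R).
exists E.
have pdfE (x : R) : 0 <= x -> exponential_pdf 1 x = expR (- x).
  by move=> x0; rewrite exponential_pdfE//= mul1r mulN1r.
have mpdf : measurable_fun setT (fun x : measurableTypeR R => (exponential_pdf 1 x)%:E).
  by apply/measurable_EFinP; exact: measurable_exponential_pdf.
have mnorm : measurable_fun setT (fun x : measurableTypeR R => `|x|).
  exact: measurableT_comp.
(* the density vanishes on the negative half-line *)
have restr (f : R -> R) (A : set R) (a : R) : 0 <= a -> measurable A ->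
    (forall x, 0 <= f x) -> measurable_fun setT f ->
    (forall x, 0 <= x -> A x <-> a <= x) ->
    (\int[lebesgue_measure]_(x in A) ((f x)%:E * (exponential_pdf 1 x)%:E) =
     \int[lebesgue_measure]_(x in `[a, +oo[) (f x * expR (- x))%:E)%E.
  move=> a0 mA f0 mf Aa.
  rewrite [LHS]integral_mkcond [RHS]integral_mkcond; apply: eq_integral => x _.
  rewrite !patchE; have [x0|x0] := leP 0 x; last first.
    rewrite lt0_exponential_pdf// mule0 if_same memNset//=.
    by rewrite in_itv/= andbT => ax; move: x0; rewrite ltNge (le_trans a0 ax).
  rewrite pdfE// -EFinM; case: ifPn; case: ifPn => //.
  - by rewrite !notin_setE/= in_itv/= andbT !inE => ax /Aa; move/(_ x0).
  - by rewrite !notin_setE/= !inE/= in_itv/= andbT => ax /(_ (proj2 (Aa _ x0) ax)).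
split.
  split => // k.
  have mk : measurable_fun setT (fun x : measurableTypeR R => (`|x| ^+ k)%:E).
    by apply/measurable_EFinP; exact: measurable_funX.
  have Ek : (\int[E]_x (`|x| ^+ k)%:E = k`!%:R%:E)%E.
    rewrite (ge0_integral_density mpdf (mu := lebesgue_measure))//.
    - rewrite (restr (fun x => `|x| ^+ k) _ 0)//.
      + transitivity (\int[lebesgue_measure]_(x in `[0%R, +oo[) (x ^+ k * expR (- x) : R)%:E)%E.
          by apply: eq_integral => x; rewrite inE/= in_itv/= andbT => x0; rewrite ger0_norm.
        rewrite integral_exprn_expRN//; congr _%:E.
        elim: k {mk} => [|k IHk] /=; first by rewrite oppr0 expR0 opprK.
        by rewrite factS natrM -IHk expr0n mul0r subr0 mulrN.
      + by apply/measurable_EFinP.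
    - by move=> A _; exact: EE.
  split; last by rewrite /Rintegral Ek.
  apply/integrableP; split; first exact: mk.
  under eq_integral do rewrite /= ger0_norm ?exprn_ge0//.
  by rewrite Ek ltry.
move=> t t0; rewrite EE /exponential_prob.
transitivity (\int[lebesgue_measure]_(x in [set x : R | (t <= `|x|)%R])
    ((cst (1 : R) x)%:E * (exponential_pdf 1 x)%:E))%E.
  by apply: eq_integral => x _; rewrite mul1e.
rewrite (restr (cst 1) _ t)//.
- by have := integral_exprn_expRN 0 t0; rewrite /= opprK.
- rewrite (_ : [set x | _] = setT `&` (fun x : measurableTypeR R => `|x|) @^-1` `[t, +oo[).
    exact: mnorm.
  by apply/seteqP; split => x /=; rewrite in_itv /= andbT // => -[].
- by move=> x x0 /=; rewrite ger0_norm.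
Qed.

Theorem exponential_of_factorial_moments d (T : measurableType d) (R : realType)
    (P : probability T R) (X : T -> R) (t : R) :
  factorial_moments P X -> 0 <= t -> P [set w | t <= X w] = (expR (- t))%:E.
Proof.
move=> XP t0; have [E [FE tE]] := exponential_law R.
by rewrite (eq_tail_factorial_moments XP FE) tE.
Qed.
(** The tail function is continuous, so strict and weak inequalities have the same
    probability; the strict form is the one that enters the formula for the mean
    as the integral of the tail. *)
Corollary exponential_of_factorial_moments_lt d (T : measurableType d) (R : realType)
    (P : probability T R) (X : T -> R) (t : R) :
  factorial_moments P X -> 0 <= t -> P [set w | t < X w] = (expR (- t))%:E.
Proof.
move=> XP t0; have [mX _ _] := XP.
have mray (b : bool) (r : R) : measurable (X @^-1` [set` Interval (BSide b r) +oo%O]).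
  by rewrite -[X in measurable X]setTI; exact: mX.
have mle r : measurable [set w | r <= X w].
  rewrite (_ : [set w | _] = X @^-1` `[r, +oo[) //.
  by apply/seteqP; split => w /=; rewrite in_itv/= andbT.
have mlt : measurable [set w | t < X w].
  rewrite (_ : [set w | _] = X @^-1` `]t, +oo[) //.
  by apply/seteqP; split => w /=; rewrite in_itv/= andbT.
have le1 : (P [set w | (t < X w)%R] <= (expR (- t))%:E)%E.
  rewrite -(exponential_of_factorial_moments XP t0); apply: le_measure; rewrite ?inE//.
  by move=> w /= /ltW.
have Pfin : P [set w | t < X w] \is a fin_num by exact: fin_num_measure.
apply/eqP; rewrite eq_le le1/= -(fineK Pfin) lee_fin.
apply/ler_addgt0Pr => e e0.
have : (expR (- (t + e)) <= fine (P [set w | t < X w]))%R.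
  rewrite -lee_fin (fineK Pfin) -(exponential_of_factorial_moments XP (addr_ge0 t0 (ltW e0))).
  apply: le_measure; rewrite ?inE//.
  by move=> w /=; apply: lt_le_trans; rewrite ltrDl.
rewrite opprD expRD => H.
have E1 : expR (- t) <= 1 by rewrite -expR0 ler_expR oppr_le0.
have E0 := expR_ge0 (- t).
have E2 := expR_ge1Dx (- e).
have : expR (- t) * (1 + - e) <= expR (- t) * expR (- e) by exact: ler_wpM2l.
nra.
Qed.
(** * Integration of functions of independent variables *)

Lemma ge0_integral_preserving d (T : measurableType d) (R : realType)
    (P : {measure set T -> \bar R}) (phi : T -> T) (h : T -> \bar R) :
  measurable_fun setT phi ->
  (forall A, measurable A -> P (phi @^-1` A) = P A) ->
  measurable_fun setT h -> (forall w, 0 <= h w)%E ->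
  (\int[P]_w h (phi w) = \int[P]_w h w)%E.
Proof.
move=> mphi Pphi mh h0; transitivity (\int[pushforward P phi]_w h w)%E.
  by rewrite ge0_integral_pushforward// preimage_setT.
by apply: eq_measure_integral => A mA _; exact: Pphi.
Qed.

Lemma exists_law d (T : measurableType d) (R : realType) (P : probability T R)
    (X : T -> R) : measurable_fun setT X ->
  exists mu : probability R R, forall A, mu A = P (X @^-1` A).
Proof.
move=> mX; pose Y : {mfun T >-> R} := mfun_Sub (mem_set mX).
by exists (distribution P Y : probability _ R).
Qed.

Lemma ge0_integral_law d (T : measurableType d) (R : realType) (P : probability T R)
    (X : T -> R) (mu : probability R R) (f : R -> \bar R) :
  measurable_fun setT X -> (forall A, mu A = P (X @^-1` A)) ->
  measurable_fun setT f -> (forall x, 0 <= f x)%E ->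
  (\int[mu]_x f x = \int[P]_w f (X w))%E.
Proof.
move=> mX muX mf f0.
transitivity (\int[pushforward P (X : T -> R)]_x f x)%E.
  by apply: eq_measure_integral => A mA _; exact: muX.
by rewrite ge0_integral_pushforward// preimage_setT.
Qed.

(** The joint law is the product of the marginal laws, because measures on a product
    are determined by rectangles; the formula is then Tonelli's theorem. *)
Lemma ge0_integral_indep d (T : measurableType d) (R : realType) (P : probability T R)
    (X Y : T -> R) (f g : R -> \bar R) :
  measurable_fun setT X -> measurable_fun setT Y ->
  (forall A B : set R, measurable A -> measurable B ->
    P (X @^-1` A `&` Y @^-1` B) = P (X @^-1` A) * P (Y @^-1` B))%E ->
  measurable_fun setT f -> measurable_fun setT g ->
  (forall x, 0 <= f x)%E -> (forall x, 0 <= g x)%E ->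
  (\int[P]_w (f (X w) * g (Y w)) = (\int[P]_w f (X w)) * \int[P]_w g (Y w))%E.
Proof.
move=> mX mY XY mf mg f0 g0.
have [muX muXE] := exists_law P mX; have [muY muYE] := exists_law P mY.
pose XxY w : R * R := (X w, Y w).
have mXY : measurable_fun setT XxY by exact/measurable_fun_pair.
pose F (z : R * R) := (f z.1 * g z.2)%E.
have mF : measurable_fun setT F.
  by apply: emeasurable_funM; apply: measurableT_comp.
have F0 z : (0 <= F z)%E by exact: mule_ge0.
transitivity (\int[(muX \x muY)%E]_z F z)%E.
  transitivity (\int[pushforward P XxY]_z F z)%E.
    by rewrite ge0_integral_pushforward// preimage_setT.
  apply: eq_measure_integral => A mA _; apply/esym; apply: product_measure_unique => //= B C mB mC.
  by rewrite muXE muYE -XY.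
rewrite fubini_tonelli1//= /fubini_F /F/=.
under eq_integral do rewrite ge0_integralZl//.
rewrite ge0_integralZr//; last exact: integral_ge0.
by rewrite (ge0_integral_law mX muXE)// (ge0_integral_law mY muYE).
Qed.

(** * The recursion for Gaussian moments *)

Lemma exprD_le (R : realDomainType) (u v : R) (m : nat) : 0 <= u -> 0 <= v ->
  (u + v) ^+ m <= 2 ^+ m * (u ^+ m + v ^+ m).
Proof.
move=> u0 v0; wlog uv : u v u0 v0 / u <= v.
  move=> H; have [uv|/ltW vu] := leP u v; first exact: H.
  by rewrite addrC [u ^+ m + _]addrC; exact: H.
apply: le_trans (_ : (2 * v) ^+ m <= _).
  by rewrite lerXn2r ?nnegrE ?addr_ge0 ?mulr_ge0// mulr_natl mulr2n lerD2r.
by rewrite exprMn ler_wpM2l ?exprn_ge0// lerDr exprn_ge0.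
Qed.
Lemma sum_even (R : comPzRingType) (F : nat -> R) (k : nat) :
  \sum_(i < (2 * k).+1) (1 + (-1) ^+ i) * F i = 2 * \sum_(j < k.+1) F (2 * j)%N.
Proof.
elim: k => [|k IHk]; first by rewrite muln0 !big_ord_recr !big_ord0/= expr0; ring.
rewrite [in RHS]big_ord_recr/= mulrDr -IHk mulnS !addSn add0n 2!big_ord_recr/=.
have -> : (-1) ^+ (2 * k).+1 = - 1 :> R by rewrite exprS exprM expr2 mulrNN mulr1 expr1n mulr1.
have -> : (-1) ^+ (2 * k).+2 = 1 :> R by rewrite 2!exprS exprM expr2 mulrNN mulr1 expr1n; ring.
ring.
Qed.

(** Only even powers of both variables survive, so that the recursion below can be
    stated without odd moments and every integrand is nonnegative. *)
Lemma even_binomial (R : comPzRingType) (x y : R) (k : nat) :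
  (y + x) ^+ (2 * k) + (y - x) ^+ (2 * k) =
  2 * \sum_(j < k.+1) 'C(2 * k, 2 * j)%:R * (x ^+ (2 * j) * y ^+ (2 * (k - j))).
Proof.
rewrite exprDn exprBn -big_split/=.
pose F i := 'C(2 * k, i)%:R * (x ^+ i * y ^+ (2 * k - i)).
rewrite (eq_bigr (fun j : 'I_k.+1 => F (2 * j)%N)); last by move=> j _; rewrite /F mulnBr.
rewrite -sum_even; apply: eq_bigr => i _; rewrite /F -[X in X + _]mulr_natr -[X in _ + X]mulr_natr.
move: (y ^+ _) (x ^+ _) ('C(_, _)%:R) ((-1) ^+ _) => a b c e; ring.
Qed.

(** The moment of order 2 k of the centred normal law of variance s. *)
Definition gauss_moment (R : numFieldType) (s : R) (k : nat) : R :=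
  (2 * k)`!%:R / (2 ^+ k * k`!%:R) * s ^+ k.

Lemma gauss_momentS (R : numFieldType) (s : R) (k : nat) :
  gauss_moment s k.+1 = (2 * k).+1%:R * s * gauss_moment s k.
Proof.
rewrite /gauss_moment mulnS !addSn add0n !factS !natrM !exprS.
have k1 : k.+1%:R != 0 :> R by rewrite pnatr_eq0.
have kf : k`!%:R != 0 :> R by rewrite pnatr_eq0 -lt0n fact_gt0.
have k2 : (2 : R) ^+ k != 0 by rewrite expf_neq0// pnatr_eq0.
have -> : (2 * k).+2%:R = 2 * k.+1%:R :> R by rewrite -natrM mulnS.
move: k1 kf k2; move: (k.+1%:R) (k`!%:R) (2 ^+ k) ((2 * k).+1%:R) ((2 * k)`!%:R) (s ^+ k).
by move=> a b c e f g a0 b0 c0; field; rewrite a0 b0 c0.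
Qed.

(** The factorials of 2 j and 2 (k - j) cancel against the binomial coefficient, which
    leaves the sum of the binomial coefficients of k. *)
Lemma sum_gauss_moment (R : numFieldType) (s : R) (k : nat) :
  \sum_(j < k.+1) 'C(2 * k, 2 * j)%:R * (gauss_moment s j * gauss_moment s (k - j)) =
  2 ^+ k * gauss_moment s k.
Proof.
have f0 n : n`!%:R != 0 :> R by rewrite pnatr_eq0 -lt0n fact_gt0.
have t0 n : 2 ^+ n != 0 :> R by rewrite expf_neq0// pnatr_eq0.
rewrite (eq_bigr (fun j : 'I_k.+1 =>
    (2 * k)`!%:R / (2 ^+ k * k`!%:R) * s ^+ k * 'C(k, j)%:R)); last first.
  move=> j _; have jk : (j <= k)%N by rewrite -ltnS.
  rewrite /gauss_moment.
  have -> : (2 * k)`!%:R = 'C(2 * k, 2 * j)%:R * ((2 * j)`!%:R * (2 * (k - j))`!%:R) :> R.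
    by rewrite -!natrM mulnBr bin_fact// leq_mul2l.
  have -> : k`!%:R = 'C(k, j)%:R * (j`!%:R * (k - j)`!%:R) :> R.
    by rewrite -!natrM bin_fact.
  have -> : 2 ^+ k = 2 ^+ j * 2 ^+ (k - j) :> R by rewrite -exprD subnKC.
  have -> : s ^+ k = s ^+ j * s ^+ (k - j) :> R by rewrite -exprD subnKC.
  have c0 : 'C(k, j)%:R != 0 :> R by rewrite pnatr_eq0 -lt0n bin_gt0.
  have := f0 j; have := f0 (k - j)%N; have := t0 j; have := t0 (k - j)%N; move: c0.
  move: ('C(k, j)%:R) (j`!%:R) ((k - j)`!%:R) (2 ^+ j) (2 ^+ (k - j)).
  move: ((2 * j)`!%:R) ((2 * (k - j))`!%:R) ('C(2 * k, 2 * j)%:R) (s ^+ j) (s ^+ (k - j)).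
  move=> a b e x y c u v p q c0 q0 p0 v0 u0; field.
  by rewrite c0 q0 p0 v0 u0.
rewrite -mulr_sumr -natr_sum.
have -> : (\sum_(j < k.+1) 'C(k, j) = 2 ^ k)%N.
  rewrite -[2%N]/(1 + 1)%N expnDn; apply: eq_bigr => j _.
  by rewrite !exp1n !muln1.
by rewrite natrX mulrC.
Qed.
(** In the recursion at k >= 2 the unknown M k appears with coefficient 2 on the left
    and 2^k on the right, so it is determined by the earlier values. *)
Lemma gauss_moment_unique (R : numFieldType) (M : nat -> R) :
  M 0%N = 1 ->
  (forall k, \sum_(j < k.+1) 'C(2 * k, 2 * j)%:R * (M j * M (k - j)%N) = 2 ^+ k * M k) ->
  forall k, M k = gauss_moment (M 1%N) k.
Proof.
move=> M0 Mrec; set s := M 1%N.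
have G0 : gauss_moment s 0 = 1 by rewrite /gauss_moment muln0 fact0 !expr0 !mulr1 divr1.
elim/ltn_ind => -[_|[_|k IH]]; first by rewrite G0.
  by rewrite gauss_momentS G0 muln0 mul1r mulr1.
(* isolate the two extreme terms, the only ones that contain M k.+2 *)
have split (F : nat -> R) :
    \sum_(j < k.+3) F j = F 0%N + \sum_(i < k.+1) F i.+1 + F k.+2.
  by rewrite big_ord_recl big_ord_recr/= addrA.
have := Mrec k.+2; have := sum_gauss_moment s k.+2.
rewrite (split (fun j => 'C(2 * k.+2, 2 * j)%:R * (M j * M (k.+2 - j)%N))).
rewrite (split (fun j => 'C(2 * k.+2, 2 * j)%:R * (gauss_moment s j * gauss_moment s (k.+2 - j)))).
rewrite !muln0 !subn0 !subnn !bin0 !binn M0 G0 !mul1r !mulr1.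
rewrite [in X in _ -> X](eq_bigr (fun i : 'I_k.+1 => 'C(2 * k.+2, 2 * i.+1)%:R *
    (gauss_moment s i.+1 * gauss_moment s (k.+2 - i.+1)%N))); last first.
  move=> i _; congr (_ * (_ * _)); apply: IH; first by rewrite ltnS ltn_ord.
  by rewrite subSS ltnS leq_subr.
move: (\sum_(i < k.+1) _) (M k.+2) (gauss_moment s k.+2) => S m g gE mE.
have p2 : (2 ^+ k.+2 - 2 : R) != 0.
  rewrite subr_eq0 -natrX eqr_nat; apply/eqP => /(congr1 (fun n => (n %/ 2)%N)).
  by rewrite expnS mulKn// expnS; case: (2 ^ k)%N (expn_gt0 2 k) => [|[]].
apply: (mulfI p2); rewrite !mulrBl -mE -gE; ring.
Qed.
(** * The Herschel-Maxwell theorem *)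

(** The rotations enter only through two measure preserving maps of the sample
    space: phi rotates (X, Y) by 45 degrees and psi sends X to Y. *)
Section Maxwell.
Context d (T : measurableType d) (R : realType) (P : probability T R).
Variables (X Y : T -> R) (phi psi : T -> T).
Hypotheses (mX : measurable_fun setT X) (mY : measurable_fun setT Y).
Hypothesis XY : forall A B : set R, measurable A -> measurable B ->
  (P (X @^-1` A `&` Y @^-1` B) = P (X @^-1` A) * P (Y @^-1` B))%E.
Hypotheses (mphi : measurable_fun setT phi) (mpsi : measurable_fun setT psi).
Hypothesis Pphi : forall A, measurable A -> P (phi @^-1` A) = P A.
Hypothesis Ppsi : forall A, measurable A -> P (psi @^-1` A) = P A.
Hypothesis phiX : forall w, X (phi w) = (X w + Y w) / Num.sqrt 2.
Hypothesis phiY : forall w, Y (phi w) = (Y w - X w) / Num.sqrt 2.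
Hypothesis psiX : forall w, X (psi w) = Y w.
Hypothesis X1 : P.-integrable setT (EFin \o X).

Let absmom (k : nat) := (\int[P]_w (`|X w| ^+ k)%:E)%E.

Let mabs (Z : T -> R) (k : nat) : measurable_fun setT Z ->
  measurable_fun setT (fun w => (`|Z w| ^+ k)%:E).
Proof.
move=> mZ; apply/measurable_EFinP; apply: measurable_funX.
exact: measurableT_comp.
Qed.

Let mpow (k : nat) : measurable_fun setT (fun x : R => (`|x| ^+ k)%:E).
Proof.
by apply/measurable_EFinP; apply: measurable_funX; exact: normr_measurable.
Qed.

Let absmomY (k : nat) : (\int[P]_w (`|Y w| ^+ k)%:E = absmom k)%E.
Proof.
rewrite /absmom -[RHS](ge0_integral_preserving mpsi Ppsi).
- by under [RHS]eq_integral do rewrite psiX.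
- exact: mabs.
- by move=> w; rewrite lee_fin exprn_ge0.
Qed.

(** Markov's inequality: the ball of radius E |X| + 1 cannot be negligible. *)
Let small_ball : exists b : R, 0 <= b /\ P [set w | `|X w| <= b] != 0%E.
Proof.
have Xfin := integrable_fin_num measurableT (integrable_norm X1).
pose b := fine (\int[P]_w (`|X w|)%:E)%E + 1.
have b0 : 0 <= b.
  by rewrite addr_ge0// fine_ge0// integral_ge0// => w _; rewrite lee_fin.
have mle : measurable [set w | `|X w| <= b].
  rewrite (_ : [set w | _] = setT `&` (fun w => `|X w|) @^-1` `]-oo, b]).
    by apply: (measurableT_comp _ mX) => //; exact: normr_measurable.
  by apply/seteqP; split => w /=; rewrite in_itv/= // => -[].
exists b; split => //; apply/eqP => Pb0.
have : (b%:E <= \int[P]_w (`|X w|)%:E)%E.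
  have <- : (\int[P]_(w in ~` [set w | (`|X w| <= b)%R]) b%:E = b%:E)%E.
    rewrite integral_cst//; last exact: measurableC.
    transitivity (b%:E * 1)%E; last by rewrite mule1.
    by congr (_ * _)%E; have := probability_setC P mle; rewrite Pb0 sube0.
  have mX1 : measurable_fun setT (fun w => (`|X w|)%:E).
    by apply/measurable_EFinP; apply: measurableT_comp.
  apply: (@le_trans _ _ (\int[P]_(w in ~` [set w | (`|X w| <= b)%R]) (`|X w|)%:E)%E).
    apply: ge0_le_integral => //.
    - exact: measurableC.
    - exact: measurable_funTS.
    - by move=> w /= /negP; rewrite -ltNge lee_fin => /ltW.
  by apply: ge0_subset_integral => //; exact: measurableC.
rewrite -(fineK Xfin) lee_fin /b; lra.
Qed.
(** The rotation identifies the law of |X Y| with that of D = |Y^2 - X^2| / 2, and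
    |X Y|^m is integrable by independence.  On the event |X| <= b one has
    Y^2 <= 2 (D + b^2); this event is independent of Y and has positive
    probability, so |Y|^(2m) is integrable over the whole space. *)
Let absmom_double (m : nat) : (absmom m < +oo -> absmom (2 * m) < +oo)%E.
Proof.
move=> Hm; have [b [b0 Pb]] := small_ball.
pose D w := `|Y w ^+ 2 - X w ^+ 2| / 2.
have D0 w : 0 <= D w by rewrite divr_ge0.
have mD : measurable_fun setT D.
  apply: measurable_funM => //; apply: measurableT_comp => //.
  by apply: measurable_funB; exact: measurable_funX.
have sq2 : Num.sqrt 2 * Num.sqrt 2 = 2 :> R by rewrite -expr2 sqr_sqrtr.
have sq20 : Num.sqrt 2 != 0 :> R by rewrite sqrtr_eq0 -ltNge ltr0n.
have DE w : D w = `|X (phi w)| * `|Y (phi w)|.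
  rewrite -normrM phiX phiY mulrACA -invfM sq2.
  by rewrite normrM [X in _ * X]ger0_norm ?invr_ge0// /D; congr (`|_| / _); ring.
have Dfin : (\int[P]_w (D w ^+ m)%:E < +oo)%E.
  have -> : (\int[P]_w (D w ^+ m)%:E = absmom m * absmom m)%E.
    rewrite -{2}absmomY -(ge0_integral_indep mX mY XY (mpow m) (mpow m)); last 2 first.
    - by move=> x; rewrite lee_fin exprn_ge0.
    - by move=> x; rewrite lee_fin exprn_ge0.
    rewrite -[RHS](ge0_integral_preserving mphi Pphi).
    - by apply: eq_integral => w _; rewrite -EFinM -exprMn DE.
    - by apply: emeasurable_funM; exact: mabs.
    - by move=> w; rewrite mule_ge0// lee_fin exprn_ge0.
  by rewrite lte_mul_pinfty// ?integral_ge0// ge0_fin_numE// integral_ge0.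
pose I (x : R) : \bar R := (\1_`[- b, b] x)%:E.
have I0 x : (0 <= I x)%E by rewrite lee_fin.
have mI : measurable_fun setT I.
  by apply/measurable_EFinP; exact: measurable_indic.
have IX : (\int[P]_w I (X w) = P [set w | (`|X w| <= b)%R])%E.
  transitivity (\int[P]_w (\1_[set w | `|X w| <= b] w)%:E)%E.
    apply: eq_integral => w _; rewrite /I !indicE; congr (_%:R%:E); congr nat_of_bool.
    by apply/idP/idP; rewrite !inE/= in_itv/= ler_norml.
  rewrite integral_indic ?setIT//.
  rewrite (_ : [set w | _] = setT `&` X @^-1` `[- b, b]); first exact: mX.
  by apply/seteqP; split => w /=; rewrite in_itv/= ler_norml// => -[].
have : (\int[P]_w (I (X w) * (`|Y w| ^+ (2 * m))%:E) < +oo)%E.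
  apply: (@le_lt_trans _ _ (\int[P]_w ((4 ^+ m)%:E * ((D w ^+ m)%:E + ((b ^+ 2) ^+ m)%:E)))%E).
    apply: ge0_le_integral => //.
    - by move=> w _; rewrite mule_ge0// lee_fin exprn_ge0.
    - by apply: emeasurable_funM; [exact: measurableT_comp|exact: mabs].
    - apply: emeasurable_funM => //; apply: emeasurable_funD => //.
      by apply/measurable_EFinP; exact: measurable_funX.
    - move=> w _; rewrite /I indicE.
      have R0 : 0 <= 4 ^+ m * (D w ^+ m + b ^+ 2 ^+ m).
        by rewrite mulr_ge0 ?addr_ge0 ?exprn_ge0// sqr_ge0.
      have [Xb|_] := boolP (X w \in `[- b, b]%classic); last first.
        by rewrite mul0e -EFinD -EFinM lee_fin.
      move: Xb; rewrite inE/= in_itv/= -ler_norml mul1e -EFinD -EFinM lee_fin => Xb.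
      rewrite exprM real_normK ?num_real//.
      have Y2 : Y w ^+ 2 <= 2 * (D w + b ^+ 2).
        have Xb2 : X w ^+ 2 <= b ^+ 2.
          by rewrite -real_normK ?num_real// lerXn2r// nnegrE.
        have := ler_norm (Y w ^+ 2 - X w ^+ 2); have := sqr_ge0 b.
        rewrite /D; lra.
      apply: le_trans (_ : (2 * (D w + b ^+ 2)) ^+ m <= _).
        by rewrite lerXn2r ?nnegrE ?sqr_ge0// mulr_ge0// addr_ge0// sqr_ge0.
      have -> : 4 ^+ m = 2 ^+ m * 2 ^+ m :> R.
        by rewrite -exprMn; congr (_ ^+ _); ring.
      rewrite exprMn -mulrA ler_wpM2l ?exprn_ge0//.
      by apply: exprD_le => //; exact: sqr_ge0.
  rewrite ge0_integralZl//; last 2 first.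
  - apply: emeasurable_funD => //.
    by apply/measurable_EFinP; exact: measurable_funX.
  - by move=> w _; rewrite -EFinD lee_fin addr_ge0 ?exprn_ge0// sqr_ge0.
  rewrite lte_mul_pinfty// ?lee_fin ?exprn_ge0//.
  rewrite ge0_integralD//; last 3 first.
  - by move=> w _; rewrite lee_fin exprn_ge0.
  - by apply/measurable_EFinP; exact: measurable_funX.
  - by move=> w _; rewrite lee_fin exprn_ge0// sqr_ge0.
  rewrite lte_add_pinfty//.
  apply: (integrable_lty measurableT).
  exact: (finite_measure_integrable_cst P ((b ^+ 2) ^+ m) measurableT).
rewrite (ge0_integral_indep mX mY XY mI (mpow (2 * m)) I0); last first.
  by move=> x; rewrite lee_fin exprn_ge0.
rewrite absmomY IX => Hfin; rewrite ltey; apply/eqP => moo.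
by move: Hfin; rewrite moo gt0_muley ?ltxx// lt0e Pb measure_ge0.
Qed.
Let absmom_fin (k : nat) : (absmom k < +oo)%E.
Proof.
have pow2 n : (absmom (2 ^ n) < +oo)%E.
  elim: n => [|n IHn]; last by rewrite expnS; exact: absmom_double.
  rewrite expn0 /absmom; under eq_integral do rewrite expr1.
  exact: (integrable_lty measurableT (integrable_norm X1)).
apply: (@le_lt_trans _ _ (\int[P]_w (1 + (`|X w| ^+ (2 ^ k))%:E))%E).
  apply: ge0_le_integral => //.
  - exact: mabs.
  - by apply: emeasurable_funD => //; exact: mabs.
  - move=> w _; rewrite -EFinD lee_fin.
    have [X1' | /ltW X1'] := leP `|X w| 1.
      by rewrite (@le_trans _ _ 1)// ?exprn_ile1// lerDl exprn_ge0.
    rewrite (le_trans (ler_weXn2l X1' (ltnW (ltn_expl k (ltnSn 1)))))//.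
    by rewrite lerDr.
rewrite ge0_integralD//; last exact: mabs.
apply: lte_add_pinfty; last exact: pow2.
apply: (integrable_lty measurableT).
exact: (finite_measure_integrable_cst P 1 measurableT).
Qed.

Let M (k : nat) : R := fine (absmom (2 * k)).

Let even_norm (x : R) (k : nat) : `|x| ^+ (2 * k) = x ^+ (2 * k).
Proof. by rewrite !exprM real_normK ?num_real. Qed.

Let even_ge0 (x : R) (k : nat) : 0 <= x ^+ (2 * k).
Proof. by rewrite exprM exprn_ge0// sqr_ge0. Qed.

(** Independence for monomials in the squares; since they are nonnegative, the
    product formula gives integrability as well. *)
Let EXY (i j : nat) :
  P.-integrable setT (EFin \o (fun w => X w ^+ (2 * i) * Y w ^+ (2 * j))) /\
  \int[P]_w (X w ^+ (2 * i) * Y w ^+ (2 * j)) = M i * M j.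
Proof.
have E : (\int[P]_w (X w ^+ (2 * i) * Y w ^+ (2 * j))%:E = (M i * M j)%:E)%E.
  rewrite EFinM !fineK ?ge0_fin_numE ?integral_ge0 ?absmom_fin//.
  rewrite -[X in (_ * X)%E]absmomY.
  rewrite -(ge0_integral_indep mX mY XY (mpow (2 * i)) (mpow (2 * j))); last 2 first.
  - by move=> x; rewrite lee_fin exprn_ge0.
  - by move=> x; rewrite lee_fin exprn_ge0.
  by apply: eq_integral => w _; rewrite -EFinM !even_norm.
split; last by rewrite /Rintegral E.
apply/integrableP; split.
  by apply/measurable_EFinP; apply: measurable_funM; exact: measurable_funX.
rewrite (_ : (fun w => _) = (fun w => (X w ^+ (2 * i) * Y w ^+ (2 * j))%:E)); last first.
  by apply/funext => w /=; rewrite ger0_norm// mulr_ge0.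
by rewrite E ltry.
Qed.

Let M0 : M 0 = 1.
Proof.
rewrite /M /absmom muln0 (eq_integral (cst 1%E)); last by move=> w _; rewrite expr0.
by rewrite integral_cst// mul1e; exact: (congr1 fine (probability_setT P)).
Qed.

(** Integrate even_binomial: its left-hand side is 2^k times the sum of the
    2k-th powers of the two rotated coordinates, each of which has mean M k. *)
Let Mrec (k : nat) :
  \sum_(j < k.+1) 'C(2 * k, 2 * j)%:R * (M j * M (k - j)%N) = 2 ^+ k * M k.
Proof.
have Ephi (Z : T -> R) : measurable_fun setT Z ->
    (\int[P]_w (Z w ^+ (2 * k))%:E = (M k)%:E)%E ->
    P.-integrable setT (EFin \o (fun w => Z (phi w) ^+ (2 * k))) /\
    \int[P]_w (Z (phi w) ^+ (2 * k)) = M k.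
  move=> mZ EZ.
  have E : (\int[P]_w (Z (phi w) ^+ (2 * k))%:E = (M k)%:E)%E.
    rewrite (ge0_integral_preserving mphi Pphi (h := fun w => (Z w ^+ (2 * k))%:E))//.
    - by apply/measurable_EFinP; exact: measurable_funX.
    - by move=> w; rewrite lee_fin.
  split; last by rewrite /Rintegral E.
  apply/integrableP; split.
    by apply/measurable_EFinP; apply: measurable_funX; exact: measurableT_comp.
  rewrite (_ : (fun w => _) = (fun w => (Z (phi w) ^+ (2 * k))%:E)); last first.
    by apply/funext => w /=; rewrite ger0_norm.
  by rewrite E ltry.
have Mk : ((M k)%:E = absmom (2 * k))%E.
  by rewrite fineK// ge0_fin_numE ?integral_ge0 ?absmom_fin.
have [iX EX] : P.-integrable setT (EFin \o (fun w => X (phi w) ^+ (2 * k))) /\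
    \int[P]_w (X (phi w) ^+ (2 * k)) = M k.
  by apply: Ephi => //; rewrite Mk; apply: eq_integral => w _; rewrite even_norm.
have [iY EY] : P.-integrable setT (EFin \o (fun w => Y (phi w) ^+ (2 * k))) /\
    \int[P]_w (Y (phi w) ^+ (2 * k)) = M k.
  by apply: Ephi => //; rewrite Mk -absmomY; apply: eq_integral => w _; rewrite even_norm.
have sum_phi w : \sum_(j < k.+1) 'C(2 * k, 2 * j)%:R *
    (X w ^+ (2 * j) * Y w ^+ (2 * (k - j))) =
    2 ^+ k / 2 * (X (phi w) ^+ (2 * k) + Y (phi w) ^+ (2 * k)).
  have := even_binomial (X w) (Y w) k.
  move: (\sum_(j < _) _) => S SE.
  rewrite phiX phiY !expr_div_n -mulrDl [X w + _]addrC SE.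
  rewrite [Num.sqrt 2 ^+ _]exprM sqr_sqrtr//.
  have p0 : (2 : R) ^+ k != 0 by rewrite expf_neq0.
  by move: p0; move: (2 ^+ k) => p p0; field.
have := @Rintegral_sum _ _ _ P k.+1 (fun j w => 'C(2 * k, 2 * j)%:R *
    (X w ^+ (2 * j) * Y w ^+ (2 * (k - j)))).
under eq_Rintegral do rewrite sum_phi.
have iC j : P.-integrable setT (EFin \o (fun w => 'C(2 * k, 2 * j)%:R *
    (X w ^+ (2 * j) * Y w ^+ (2 * (k - j))))).
  have := integrableZl measurableT ('C(2 * k, 2 * j)%:R) (EXY j (k - j)).1.
  by apply: eq_integrable.
move=> /(_ (fun j _ => iC j)) E.
rewrite (eq_bigr (fun j : 'I_k.+1 => \int[P]_w ('C(2 * k, 2 * j)%:R *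
    (X w ^+ (2 * j) * Y w ^+ (2 * (k - j)))))); last first.
  by move=> j _; have [i1 <-] := EXY j (k - j); rewrite RintegralZl.
rewrite -E RintegralZl//; last first.
  by have := integrableD measurableT iX iY; apply: eq_integrable.
by rewrite RintegralD// EX EY; field.
Qed.
Let ME (k : nat) : M k = gauss_moment (M 1%N) k.
Proof. exact: gauss_moment_unique M0 Mrec k. Qed.

Let S w := X w ^+ 2 + Y w ^+ 2.

Let iS (k : nat) : P.-integrable setT (EFin \o (fun w => S w ^+ k)).
Proof.
have := @integrable_Rsum _ _ _ P k.+1 (fun j w =>
  'C(k, j)%:R * (X w ^+ (2 * j) * Y w ^+ (2 * (k - j)))).
have -> : (fun w => \sum_(j < k.+1) 'C(k, j)%:R * (X w ^+ (2 * j) * Y w ^+ (2 * (k - j)))) =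
    (fun w => S w ^+ k).
  apply/funext => w; rewrite /S addrC exprDn; apply: eq_bigr => j _.
  by rewrite -!exprM -[RHS]mulr_natl [Y w ^+ _ * _]mulrC.
apply=> j _; have := integrableZl measurableT ('C(k, j)%:R) (EXY j (k - j)).1.
by apply: eq_integrable.
Qed.

(** Expand S^(k+1) = S^k X^2 + S^k Y^2 and use M (j + 1) = (2 j + 1) s M j for the
    Gaussian moments: in each term the two factors add up to 2 (k + 1) s, for
    the same reason as in Gaussian integration by parts. *)
Let ES_S (k : nat) : \int[P]_w (S w ^+ k.+1) = 2 * k.+1%:R * M 1%N * \int[P]_w (S w ^+ k).
Proof.
pose c j w := 'C(k, j)%:R * (X w ^+ (2 * j) * Y w ^+ (2 * (k - j))).
pose c' j w := 'C(k, j)%:R * (X w ^+ (2 * j.+1) * Y w ^+ (2 * (k - j)) +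
  X w ^+ (2 * j) * Y w ^+ (2 * (k - j).+1)).
have ic j : P.-integrable setT (EFin \o c j).
  have := integrableZl measurableT ('C(k, j)%:R) (EXY j (k - j)).1.
  by apply: eq_integrable.
have iXY j : P.-integrable setT (EFin \o (fun w => X w ^+ (2 * j.+1) * Y w ^+ (2 * (k - j)) +
    X w ^+ (2 * j) * Y w ^+ (2 * (k - j).+1))).
  have := integrableD measurableT (EXY j.+1 (k - j)).1 (EXY j (k - j).+1).1.
  by apply: eq_integrable.
have ic' j : P.-integrable setT (EFin \o c' j).
  by have := integrableZl measurableT ('C(k, j)%:R) (iXY j); apply: eq_integrable.
have SE w : S w ^+ k = \sum_(j < k.+1) c j w.
  rewrite /S addrC exprDn; apply: eq_bigr => j _.
  by rewrite /c -!exprM -mulr_natl [Y w ^+ _ * _]mulrC.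
have SE' w : S w ^+ k.+1 = \sum_(j < k.+1) c' j w.
  rewrite exprSr SE mulr_suml; apply: eq_bigr => j _.
  rewrite /c /c' /S -mulrA; congr (_ * _).
  by rewrite !mulnS !exprD; ring.
under eq_Rintegral do rewrite SE'.
under [in RHS]eq_Rintegral do rewrite SE.
rewrite !Rintegral_sum// mulr_sumr; apply: eq_bigr => j _.
rewrite !RintegralZl//; last exact: (EXY j (k - j)).1.
rewrite RintegralD//; last 2 first.
- exact: (EXY j.+1 (k - j)).1.
- exact: (EXY j (k - j).+1).1.
rewrite (EXY _ _).2 (EXY _ _).2 (EXY _ _).2.
rewrite !(ME j) !(ME j.+1) !(ME (k - j)) !(ME (k - j).+1) !gauss_momentS.
have -> : k.+1%:R = j%:R + (k - j)%:R + 1 :> R.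
  by rewrite -natrD subnKC ?natr1// -ltnS.
rewrite -!natr1 !natrM; move: (gauss_moment (M 1%N) j) (gauss_moment (M 1%N) (k - j)) => a b.
move: (M 1%N) => s.
move: ('C(_, _)%:R) (j%:R) ((k - j)%:R) => x y z; ring.
Qed.

Let M1E : \int[P]_w (X w ^+ 2) = M 1%N.
Proof.
rewrite -[RHS]mulr1 -M0 -(EXY 1 0).2; apply: eq_Rintegral => w _.
by rewrite muln1 muln0 mulr1.
Qed.

Let ES0 : \int[P]_w (S w ^+ 0) = 1.
Proof.
rewrite -[RHS]mulr1 -{1}M0 -M0 -(EXY 0 0).2; apply: eq_Rintegral => w _.
by rewrite !muln0 !expr0 mulr1.
Qed.

(** When E X^2 = 0 this forces the radius to vanish almost surely, which contradicts
    a positive mean of the norm. *)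
Lemma maxwell_radius_sqr :
  P.-integrable setT (EFin \o (fun w => X w ^+ 2 + Y w ^+ 2)) /\
  \int[P]_w (X w ^+ 2 + Y w ^+ 2) = 2 * \int[P]_w (X w ^+ 2).
Proof.
split; first exact: (iS 1).
by have := ES_S 0; rewrite ES0 M1E !mulr1.
Qed.

Theorem maxwell_factorial_moments : \int[P]_w (X w ^+ 2) != 0 ->
  factorial_moments P
    (fun w => (X w ^+ 2 + Y w ^+ 2) / (2 * \int[P]_w (X w ^+ 2))).
Proof.
rewrite M1E.
set s := M 1%N => s0.
have s1 : 0 < s by rewrite lt0r s0 /s /M fine_ge0// integral_ge0.
have s20 : 2 * s != 0 by rewrite mulf_neq0.
split.
- apply: measurable_funM => //.
  by apply: measurable_funD; exact: measurable_funX.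
- by move=> w; rewrite divr_ge0 ?addr_ge0 ?sqr_ge0// mulr_ge0// ltW.
- move=> k; have Ek w : ((X w ^+ 2 + Y w ^+ 2) / (2 * s)) ^+ k = (2 * s)^-1 ^+ k * S w ^+ k.
    by rewrite exprMn mulrC.
  split.
    have := integrableZl measurableT ((2 * s)^-1 ^+ k) (iS k).
    by apply: eq_integrable => // w _; rewrite /= Ek EFinM.
  under eq_Rintegral do rewrite Ek.
  rewrite RintegralZl//.
  have -> : \int[P]_w (S w ^+ k) = (2 * s) ^+ k * k`!%:R.
    elim: k {Ek} => [|k IHk].
      by rewrite ES0 fact0 expr0 mulr1.
    by rewrite ES_S IHk factS natrM exprS -/s; ring.
  by rewrite mulrA -exprMn mulVf// expr1n mul1r.
Qed.

End Maxwell.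
(** * The canonical measure on the complex line *)

Lemma measurable_Re (R : realType) :
  measurable_fun [set: borelC R] (fun z : borelC R => complex.Re (z : R[i])).
Proof.
apply: (measurability _ (RGenOInfty.measurableE R)) => _ [_ [a ->] <-].
rewrite setTI; apply: sub_sigma_algebra.
rewrite openE => z /=; rewrite in_itv/= andbT => az.
apply/nbhs_ballP; exists ((complex.Re z - a)%:C)%C => /=.
  by rewrite ltcE /= eqxx subr_gt0.
move=> y; rewrite -ball_normE /= ltcE /= => /andP[_ zy].
rewrite in_itv/= andbT.
have : complex.Re (z - y) <= complex.Re `|z - y|.
  apply: (le_trans (ler_norm _)).
  by have := normc_ge_Re (z - y); rewrite lecE /= => /andP[_].
rewrite raddfB/=; lra.
Qed.

Lemma measurable_mulC (R : realType) (w : R[i]) :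
  measurable_fun [set: borelC R] (fun z : borelC R => w * (z : R[i]) : borelC R).
Proof.
apply: (@measurability _ _ (borelC R) (borelC R) setT _ (@open (R[i])^o)) => // _ [A oA <-].
rewrite setTI; apply: sub_sigma_algebra.
have := (@continuousP (R[i])^o (R[i])^o ( *%R w)).1; apply => //.
exact: mulrl_continuous.
Qed.

Lemma measurable_Im (R : realType) :
  measurable_fun [set: borelC R] (fun z : borelC R => complex.Im (z : R[i])).
Proof.
rewrite (_ : (fun z : borelC R => _) =
    (fun z : borelC R => complex.Re (z : R[i])) \o (fun z : borelC R => - 'i%C * (z : R[i]))).
  by apply: (measurableT_comp (@measurable_Re R)); exact: measurable_mulC.
by apply/funext => -[x y]; rewrite /=; ring.
Qed.

Section CanonicalMeasure.
Context (R : realType) (D : arakelov_divisor R) (dp : probability (borelC R) R).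
Hypothesis hdp : is_canonical_measure D dp.

Let X (z : borelC R) : R := complex.Re (z : R[i]).
Let Y (z : borelC R) : R := complex.Im (z : R[i]).
Let scale : R := expR (- inf_part D).
Let S z := X z ^+ 2 + Y z ^+ 2.

Let scale_gt0 : 0 < scale. Proof. exact: expR_gt0. Qed.

Let S_ge0 z : 0 <= S z. Proof. by rewrite addr_ge0 ?sqr_ge0. Qed.

Let normEE (z : borelC R) : normE D z = scale * Num.sqrt (S z).
Proof. by rewrite /normE normc_def. Qed.

Let mS : measurable_fun setT S.
Proof.
by apply: measurable_funD; apply: measurable_funX; [exact: measurable_Re|exact: measurable_Im].
Qed.

Lemma measurable_normE : measurable_fun [set: borelC R] (normE D : borelC R -> R).
Proof.
rewrite (_ : (normE D : borelC R -> R) = (fun z => scale * Num.sqrt (S z))); last first.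
  by apply/funext => z; rewrite normEE.
apply: measurable_funM => //; apply: measurableT_comp mS => //.
by apply: continuous_measurable_fun; exact: sqrt_continuous.
Qed.

Let normE_ge0 z : 0 <= normE D z.
Proof. by rewrite normEE mulr_ge0 ?sqrtr_ge0// ltW. Qed.

Let normE_int : dp.-integrable setT (EFin \o (normE D : borelC R -> R)).
Proof.
apply/integrableP; split; first by apply/measurable_EFinP; exact: measurable_normE.
under eq_integral do rewrite /= ger0_norm//.
by rewrite (cm_mean hdp) ltry.
Qed.

Let X1 : dp.-integrable setT (EFin \o X).
Proof.
have := integrableZl measurableT scale^-1 normE_int.
apply: le_integrable => //; first by apply/measurable_EFinP; exact: measurable_Re.
move=> z _; rewrite /= lee_fin normEE mulKf ?gt_eqF//.
rewrite [leRHS]ger0_norm ?sqrtr_ge0// -sqrtr_sqr ler_sqrt ?S_ge0//.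
by rewrite lerDl sqr_ge0.
Qed.

Let XY (A B : set R) : measurable A -> measurable B ->
  (dp (X @^-1` A `&` Y @^-1` B) = dp (X @^-1` A) * dp (Y @^-1` B))%E.
Proof.
apply: (cm_independent hdp).
- by split=> [z w|a [x y]]; rewrite /X ?raddfD//=; ring.
- by split=> [z w|a [x y]]; rewrite /Y ?raddfD//=; ring.
- have s2 : scale ^+ 2 != 0 by rewrite expf_neq0 ?gt_eqF.
  (* the Riesz representatives; scale ^- 2 cancels the factor in innerE *)
  exists (scale ^- 2 +i* 0)%C, (0 +i* scale ^- 2)%C; split.
  + by move=> [x y]; rewrite /innerE -/scale /X/= oppr0 mulr0 subr0 mulrCA divff ?mulr1.
  + by move=> [x y]; rewrite /innerE -/scale /Y/= mulr0 sub0r -mulrN opprK mulrCA divff ?mulr1.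
  + by rewrite /innerE -/scale/= !(mulr0, mul0r, oppr0, subr0).
Qed.

Let phi_angle : R[i] := ((Num.sqrt 2)^-1 +i* - (Num.sqrt 2)^-1)%C.
Let psi_angle : R[i] := (- 'i)%C.

Let unit_phi : `|phi_angle| = 1.
Proof.
rewrite normc_def/= sqrrN exprVn sqr_sqrtr//.
by have -> : 2^-1 + 2^-1 = 1 :> R; [field|rewrite sqrtr1].
Qed.

Let unit_psi : `|psi_angle| = 1.
Proof. by rewrite normc_def/= oppr0 expr0n add0r sqrrN expr1n sqrtr1. Qed.

Let sqX : R := \int[dp]_z (X z ^+ 2).

Let mulC_pres (w : R[i]) : `|w| = 1 -> forall A, measurable A ->
  dp ((fun z : borelC R => w * (z : R[i]) : borelC R) @^-1` A) = dp A.
Proof. by move=> w1 A mA; exact: (cm_rotation hdp). Qed.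

Let phiX (z : borelC R) : X (phi_angle * (z : R[i])) = (X z + Y z) / Num.sqrt 2.
Proof. by case: z => x y; rewrite /X /Y/=; ring. Qed.

Let phiY (z : borelC R) : Y (phi_angle * (z : R[i])) = (Y z - X z) / Num.sqrt 2.
Proof. by case: z => x y; rewrite /X /Y/=; ring. Qed.

Let psiX (z : borelC R) : X (psi_angle * (z : R[i])) = Y z.
Proof. by case: z => x y; rewrite /X /Y/=; ring. Qed.

Let mphi := @measurable_mulC R phi_angle.
Let mpsi := @measurable_mulC R psi_angle.

Let radius_sqr := maxwell_radius_sqr (@measurable_Re R) (@measurable_Im R) XY
  mphi mpsi (mulC_pres unit_phi) (mulC_pres unit_psi) phiX phiY psiX X1.

Let mean : \int[dp]_z normE D z = 2^-1.
Proof. by rewrite /Rintegral (cm_mean hdp). Qed.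

(** If the second moment vanished, r <= 1/4 + r^2 would bound the mean of the norm
    by 1/4. *)
Let sqX_neq0 : sqX != 0.
Proof.
apply/eqP => sqX0; have [iS ES] := radius_sqr.
have normE2 (z : borelC R) : normE D z <= 4^-1 + scale ^+ 2 * S z.
  rewrite normEE -{2}(sqr_sqrtr (S_ge0 z)) -exprMn.
  have := sqr_ge0 (scale * Num.sqrt (S z) - 2^-1); rewrite sqrrB; lra.
have iS2 : dp.-integrable setT (EFin \o (fun z : borelC R => scale ^+ 2 * S z)).
  by have := integrableZl measurableT (scale ^+ 2) iS; apply: eq_integrable.
have i4 := finite_measure_integrable_cst dp 4^-1 measurableT.
have : \int[dp]_z normE D z <= \int[dp]_z (4^-1 + scale ^+ 2 * S z).
  apply: le_Rintegral => //.
  by have := integrableD measurableT i4 iS2; apply: eq_integrable.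
rewrite mean RintegralD// RintegralZl//= ES -/sqX sqX0 !mulr0 addr0.
rewrite Rintegral_cst//= probability_setT/=; lra.
Qed.

Let radial := maxwell_factorial_moments (@measurable_Re R) (@measurable_Im R) XY
  mphi mpsi (mulC_pres unit_phi) (mulC_pres unit_psi) phiX phiY psiX X1 sqX_neq0.

Let sqX_gt0 : 0 < sqX.
Proof. by rewrite lt0r sqX_neq0 Rintegral_ge0// => z _; exact: sqr_ge0. Qed.

(** The radius normalised so that its tail is gauss_fun. *)
Let N (z : borelC R) : R := Num.sqrt (S z / (2 * sqX)).

Let c : R := scale * Num.sqrt (2 * sqX).

Let c_gt0 : 0 < c.
Proof. by rewrite mulr_gt0// sqrtr_gt0 mulr_gt0. Qed.

Let normEN (z : borelC R) : normE D z = c * N z.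
Proof.
have sX0 : 0 <= 2 * sqX by rewrite mulr_ge0// ltW.
rewrite normEE /c /N -mulrA -sqrtrM//; congr (_ * Num.sqrt _).
by rewrite mulrCA divff ?mulr1// mulf_neq0.
Qed.

Let rad_ge0 z : 0 <= S z / (2 * sqX).
Proof. by rewrite divr_ge0// mulr_ge0// ltW. Qed.

Let mN : measurable_fun setT N.
Proof.
have [mrad _ _] := radial.
apply: (measurableT_comp _ mrad).
by apply: continuous_measurable_fun; exact: sqrt_continuous.
Qed.

Let ltN (z : borelC R) (r : R) : 0 <= r -> (r ^+ 2 < S z / (2 * sqX)) = (r < N z).
Proof.
by move=> r0; rewrite -{1}(sqr_sqrtr (rad_ge0 z)) ltr_pXn2r// nnegrE// sqrtr_ge0.
Qed.

Let leN (z : borelC R) (r : R) : 0 <= r -> (r ^+ 2 <= S z / (2 * sqX)) = (r <= N z).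
Proof.
by move=> r0; rewrite -{1}(sqr_sqrtr (rad_ge0 z)) ler_pXn2r// nnegrE// sqrtr_ge0.
Qed.

Let tailN (r : R) : 0 <= r -> dp [set z | r < N z] = (gauss_fun r)%:E.
Proof.
move=> r0; rewrite -(exponential_of_factorial_moments_lt radial (sqr_ge0 r)).
congr (dp _); apply/seteqP; split => z /=.
- by rewrite -ltN.
- by move=> h; rewrite -(ltN z r0).
Qed.

Let meanN : \int[dp]_z N z = Num.sqrt pi / 2.
Proof.
pose V : {RV dp >-> R} := mfun_Sub (mem_set mN).
have EV : ('E_dp[V] = (Num.sqrt pi / 2)%:E)%E.
  rewrite ge0_expectation_ccdf; last by move=> z; exact: sqrtr_ge0.
  rewrite -integral0y_gauss; apply: eq_integral => r.
  rewrite inE/= in_itv/= andbT => r0; rewrite -tailN//.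
  by congr (dp _); apply/seteqP; split => z /=; rewrite in_itv/= andbT.
by rewrite unlock in EV; rewrite /Rintegral EV.
Qed.

(** The mean 1/2 of the norm against the mean sqrt pi / 2 of N. *)
Let cE : c * Num.sqrt pi = 1.
Proof.
have iN : dp.-integrable setT (EFin \o N).
  have := integrableZl measurableT c^-1 normE_int; apply: eq_integrable => // z _.
  by rewrite /= -EFinM normEN mulKf// gt_eqF.
have := mean; under eq_Rintegral do rewrite normEN.
by rewrite RintegralZl// meanN; lra.
Qed.

(** The norm is c N with c = 1 / sqrt pi, and N^2 is exponentially distributed. *)
Theorem canonical_measure_tail (r : R) : 0 <= r ->
  dp [set z | r <= normE D z] = (expR (- (pi * r ^+ 2)))%:E.
Proof.
move=> r0.
have -> : pi * r ^+ 2 = (r / c) ^+ 2.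
  rewrite expr_div_n -[RHS]mul1r -[in RHS](expr1n _ 2) -cE exprMn sqr_sqrtr ?pi_ge0//.
  by rewrite [RHS]mulrCA [X in _ = _ * X]mulrAC divff ?expf_neq0 ?gt_eqF// mul1r mulrC.
rewrite -(exponential_of_factorial_moments radial (sqr_ge0 (r / c))).
have rc0 : 0 <= r / c by rewrite divr_ge0// ltW.
by congr (dp _); apply/seteqP; split => z /=; rewrite normEN leN// ler_pdivrMr// mulrC.
Qed.

End CanonicalMeasure.
(** * Sums over countable sets *)

Lemma counting_esum (R : realType) (T : choiceType) (A : set T) :
  counting A = (\esum_(x in A) 1)%E :> \bar R.
Proof.
have sum1 (s : seq T) : \sum_(i <- s) 1 = (size s)%:R :> R.
  by rewrite -sum1_size natr_sum.
rewrite /counting; case: asboolP => [finA|infA].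
  by rewrite esum_fset// fsbig_finite//= sumEFin sum1.
apply/esym/eqyP => M M0.
have [B BA MB] := @infinite_set_fset _ A (Num.bound M) infA.
apply: esum_ge; exists [set` B]; first by split=> //; exact: finite_fset.
rewrite fsbig_finite ?set_fsetK//= sumEFin sum1 lee_fin.
have /ltW := archi_boundP (ltW M0).
by move/le_trans; apply; rewrite ler_nat.
Qed.

Lemma esum_pickle (R : realType) (T : countType) (L : set T) (a : T -> \bar R) :
  (forall i, (0 <= a i)%E) ->
  (\esum_(i in L) a i =
   \sum_(n <oo) (if pickle_inv n is Some i then if i \in L then a i else 0 else 0))%E.
Proof.
move=> a0.
pose b (n : nat) : \bar R :=
  (if @pickle_inv T n is Some i then if i \in L then a i else 0 else 0)%E.
have b0 n : (0 <= b n)%E by rewrite /b; case: (pickle_inv n) => // i; case: ifP.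
rewrite nneseries_esumT// esum_mkcond.
transitivity (\esum_(i in [set: T]) b (choice.pickle i))%E.
  by apply: eq_esum => i _; rewrite /b pickleK_inv.
rewrite -(@esum_image _ _ _ setT (@choice.pickle T) b); last first.
  by move=> x y _ _; exact: (pcan_inj pickleK_inv).
rewrite esum_mkcond; apply: eq_esum => n _; case: ifPn => //.
rewrite notin_setE /b => nr; have := @pickle_invK T n.
by case: (pickle_inv n) => //= i pin; case: nr; exists i.
Qed.

Lemma ge0_integral_esum d (T : measurableType d) (R : realType)
    (P : {measure set T -> \bar R}) (I : countType) (L : set I) (f : I -> T -> \bar R) :
  (forall i, measurable_fun setT (f i)) -> (forall i w, (0 <= f i w)%E) ->
  (\int[P]_w (\esum_(i in L) f i w) = \esum_(i in L) (\int[P]_w f i w))%E.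
Proof.
move=> mf f0.
pose g n w : \bar R := (if @pickle_inv I n is Some i then if i \in L then f i w else 0 else 0)%E.
have g0 n w : (0 <= g n w)%E by rewrite /g; case: (pickle_inv n) => // i; case: ifP.
under eq_integral do rewrite esum_pickle//.
rewrite (@integral_nneseries _ _ _ _ _ measurableT g)//; last first.
  by move=> n; rewrite /g; case: (pickle_inv n) => // i; case: (i \in L).
rewrite esum_pickle; last by move=> i; exact: integral_ge0.
apply: eq_eseriesr => n _; rewrite /g; case: (pickle_inv n) => [i|]; last by rewrite integral0.
by case: (i \in L) => //; rewrite integral0.
Qed.
(** * The lattice of global sections *)

(** If p divides the denominator of q it does not divide the numerator, and then
    |q|_p is p to the power given by the denominator. *)
Lemma denq_logn_le (R : realType) (D : arakelov_divisor R) (q : rat)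
    (p : {p : nat | prime p}) : sections D q ->
  (logn (sval p) `|denq q| <= if p \in finsupp (fin_part D) then `|fin_part D p| else 0)%N.
Proof.
move=> [Lin Lout].
have [->|q0] := eqVneq q 0; first by rewrite (denq_int 0) logn1.
have p1 : 1 < (sval p)%:R :> rat by rewrite ltr1n prime_gt1//; exact: (valP p).
have [->//|] := posnP (logn (sval p) `|denq q|).
rewrite logn_gt0 mem_primes => /and3P[pp _ pd].
have num0 : logn (sval p) `|numq q| = 0%N.
  apply/eqP; rewrite -leqn0 leqNgt logn_gt0 mem_primes; apply/negP => /and3P[_ _ pn].
  have := coprime_num_den q; rewrite /coprime => /eqP cop.
  have := prime_gt1 pp; have : (sval p %| gcdn `|numq q| `|denq q|)%N by rewrite dvdn_gcd pn pd.
  by rewrite cop dvdn1 => /eqP ->.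
have absE : padic_abs (sval p) q = (sval p)%:R ^ (logn (sval p) `|denq q|)%:Z.
  by rewrite /padic_abs (negbTE q0) /padic_val num0 sub0r opprK.
case: ifPn => pD.
- have := Lin p pD; rewrite absE ler_eXz2l// => h.
  by move: h; case: (fin_part D p) => // n; rewrite lez_nat.
- by have := Lout p pD; rewrite absE -(expr0z (sval p)%:R) ler_eXz2l.
Qed.

(** The common denominator is the product of the p_j^|u_j|; taking |u_j| in place
    of max (u_j, 0) loses nothing for a mere bound. *)
Lemma sections_denq_bounded (R : realType) (D : arakelov_divisor R) :
  exists2 M : nat, (0 < M)%N & forall q, sections D q -> (`|denq q| %| M)%N.
Proof.
exists (\prod_(p <- finsupp (fin_part D)) (sval p ^ `|fin_part D p|))%N.
  by rewrite prodn_cond_gt0// => p _; rewrite expn_gt0 prime_gt0//; exact: (valP p).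
move=> q Lq; apply/dvdn_partP; first by rewrite absz_gt0 denq_neq0.
move=> p; rewrite mem_primes => /and3P[pp _ _]; rewrite p_part.
have := @denq_logn_le _ _ _ (exist _ p pp) Lq; rewrite /=.
case: ifPn => [pD le|_]; last by rewrite leqn0 => /eqP ->; rewrite expn0 dvd1n.
rewrite (big_fsetD1 _ pD)/= dvdn_mulr//; exact: dvdn_exp2l.
Qed.

(** The integers are split into the images of the constructors Posz and Negz, and
    each half is a geometric series; Negz n has absolute value n + 1. *)
Lemma esum_int_geometric (R : realType) (r : R) : 0 <= r -> r < 1 ->
  (\esum_(m in [set: int]) (r ^+ `|m|%N)%:E < +oo)%E.
Proof.
move=> r0 r1.
have geo (k : nat) : (\esum_(n in [set: nat]) (r ^+ (n + k))%:E < +oo)%E.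
  rewrite -nneseries_esumT; last by move=> n; rewrite lee_fin exprn_ge0.
  have cvgg : series (geometric (r ^+ k) r) @ \oo --> r ^+ k / (1 - r).
    by apply: cvg_geometric_series; rewrite ger0_norm.
  rewrite (_ : (fun n => _) = EFin \o series (geometric (r ^+ k) r)).
    rewrite EFin_lim; first exact: ltry.
    by apply/cvg_ex; eexists; exact: cvgg.
  apply/funext => n /=; rewrite sumEFin /series/=; congr _%:E.
  by apply: eq_bigr => i _; rewrite addnC exprD.
rewrite (esumID (range Posz)); last by move=> m _; rewrite lee_fin exprn_ge0.
rewrite !setTI (_ : ~` range Posz = range Negz); last first.
  apply/seteqP; split => [[n|n] /=|_ [n _ <-] [m _]//].
  - by case; exists n.
  - by move=> _; exists n.
rewrite !esum_image; [|by move=> x y _ _ []|by move=> x y _ _ []].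
apply: lte_add_pinfty.
- by under eq_esum do rewrite -(addn0 `|_|%N); exact: (geo 0%N).
- rewrite (eq_esum (b := fun n => (r ^+ (n + 1))%:E)); first exact: geo.
  by move=> n _; rewrite addn1.
Qed.

(** Multiplication by a common denominator M embeds the sections into the
    integers, and m <= m^2 turns the Gaussian terms into geometric ones. *)
Lemma theta_series_finite (R : realType) (D : arakelov_divisor R) (c : R) : 0 < c ->
  (\esum_(q in sections D) (expR (- (c * (ratr q : R) ^+ 2)))%:E < +oo)%E.
Proof.
move=> c0; have [M M0 LM] := sections_denq_bounded D.
pose r := expR (- (c / M%:R ^+ 2)).
have MR0 : 0 < M%:R :> R by rewrite ltr0n.
pose e (q : rat) : int := numq (q * M%:R).
have eE q : sections D q -> ratr q = (e q)%:~R / M%:R :> R.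
  move=> /LM /dvdnP[k Mk].
  have qM : q * M%:R = (numq q * k%:Z)%:~R.
    rewrite -{1}(divq_num_den q) Mk natrM [(`|denq q|)%:R]pmulrn absz_denq.
    by rewrite mulrCA mulrAC -mulrA divff ?intr_eq0 ?denq_neq0// mulr1 intrM mulrC.
  have -> : (e q)%:~R = ratr (q * M%:R) :> R by rewrite /e qM numq_int ratr_int.
  by rewrite rmorphM/= ratr_nat mulfK// gt_eqF.
apply: le_lt_trans (_ : (\esum_(q in sections D) (r ^+ `|e q|%N)%:E < +oo)%E).
  apply: le_esum => q Lq; rewrite lee_fin eE// /r -expRM_natl ler_expR mulrN lerN2.
  have e2 : (`|e q|%N)%:R <= ((e q)%:~R : R) ^+ 2.
    rewrite -real_normK ?num_real// -intr_norm -abszE -pmulrn -natrX ler_nat.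
    by rewrite expnS expn1; case: (`|e q|)%N => // n; rewrite leq_pmulr.
  rewrite expr_div_n [leRHS]mulrCA; apply: ler_wpM2r => //.
  by rewrite divr_ge0 ?exprn_ge0// ltW.
have einj : set_inj (sections D) e.
  move=> x y; rewrite !inE => Lx Ly exy.
  by apply: (@fmorph_inj _ R (@ratr R)); rewrite /= !eE// exy.
rewrite -(@esum_image _ _ _ _ _ (fun m : int => (r ^+ `|m|%N)%:E) einj).
have r1 : r < 1 by rewrite expR_lt1 oppr_lt0 divr_gt0// exprn_gt0.
apply: le_lt_trans (esum_int_geometric (expR_ge0 _) r1).
rewrite esum_mkcond; apply: le_esum => m _; case: ifP => // _.
Qed.

Lemma norm_ratrC (R : realType) (q : rat) :
  complex.Re `|ratr q : R[i]| = `|ratr q : R|.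
Proof.
rewrite -(fmorph_rat (real_complex R)) normc_def/= expr0n addr0.
exact: sqrtr_sqr.
Qed.

Lemma bracket_esum (R : realType) (D : arakelov_divisor R) (xi : R[i]) :
  bracket D xi = (\esum_(q in sections D)
    (\1_[set z : R[i] | (normE D (ratr q) <= normE D z)%R] xi)%:E)%E.
Proof.
rewrite /bracket counting_esum.
have -> : [set l | sectionsC D l /\ normE D l <= normE D xi] =
    (fun q : rat => ratr q : R[i]) @`
      (sections D `&` [set q | normE D (ratr q) <= normE D xi]).
  apply/seteqP; split => [l [[q Lq <-] lxi]|_ [q [Lq qxi] <-]]; first by exists q.
  by split => //; exists q.
rewrite esum_image; last by move=> x y _ _; exact: (@fmorph_inj _ _ (@ratr R[i])).
rewrite esum_mkcondr; apply: eq_esum => q _.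
by rewrite indicE; case: ifPn; rewrite ?inE ?notin_setE/= => H; [rewrite mem_set|rewrite memNset].
Qed.

(** * The theta invariant as a mean number of sections *)

Theorem theorem3p3 (R : realType) (D : arakelov_divisor R)
    (dp : probability (borelC R) R) (hdp : is_canonical_measure D dp) :
  ((expR (h0_theta D))%:E = \int[dp]_xi bracket D xi)%E.
Proof.
have mtail (r : R) : measurable ([set z | r <= normE D z] : set (borelC R)).
  rewrite (_ : [set z | _] = setT `&` (normE D : borelC R -> R) @^-1` `[r, +oo[).
    exact: measurable_normE.
  by apply/seteqP; split => z /=; rewrite in_itv/= andbT // => -[].
pose N (q : rat) : R := expR (- inf_part D) * `|ratr q : R|.
have normEN q : normE D (ratr q) = N q by rewrite /normE norm_ratrC.
under eq_integral do rewrite bracket_esum.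
rewrite ge0_integral_esum//; last first.
  by move=> q; apply/measurable_EFinP; apply: measurable_indic; exact: mtail.
have -> : (\esum_(q in sections D) (\int[dp]_z
      (\1_[set z : R[i] | (normE D (ratr q) <= normE D z)%R] z)%:E) =
    \esum_(q in sections D) (expR (- (pi * N q ^+ 2)))%:E)%E.
  apply: eq_esum => q _; rewrite integral_indic//.
  rewrite setIT normEN; apply: (canonical_measure_tail hdp).
  by rewrite mulr_ge0// expR_ge0.
rewrite /h0_theta /theta_invariant -/N.
set Theta := (\esum_(q in _) _)%E.
have Theta_fin : Theta \is a fin_num.
  rewrite ge0_fin_numE; last by apply: esum_ge0 => q _; rewrite lee_fin expR_ge0.
  have c0 : 0 < pi * expR (- inf_part D) ^+ 2 by rewrite mulr_gt0 ?pi_gt0// exprn_gt0 ?expR_gt0.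
  apply: le_lt_trans (theta_series_finite D c0).
  apply: le_esum => q _; rewrite lee_fin ler_expR lerN2 /N.
  rewrite [((expR _ * _) ^+ 2)]exprMn real_normK ?num_real//.
  by rewrite [leRHS]mulrA.
have Theta_gt0 : 0 < fine Theta.
  have L0 : sections D 0.
    by split => p _; rewrite /padic_abs eqxx ?ler01// exprz_ge0.
  rewrite fine_gt0// ltey_eq Theta_fin andbT.
  apply: (@lt_le_trans _ _ (expR (- (pi * N 0 ^+ 2)))%:E); first by rewrite lte_fin expR_gt0.
  apply: esum_ge; exists [set 0]; last by rewrite fsbig_set1.
  by split; [exact: finite_set1|move=> _ ->].
by rewrite lnK ?posrE// fineK.
Qed.
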